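(* Let $L>0$, $\Omega=(-L,L)$, $\Gamma=\{-L,L\}$, and let $(\Gamma_D,\Gamma_N)$ be one of $(\emptyset,\Gamma)$, $(\{L\},\{-L\})$, $(\{-L\},\{L\})$. Let $\mathcal{H}=\{v\in H^1(\Omega):v=0\text{ on }\Gamma_D\}$ and $\omega\ge\omega_0>0$. Let $a,c\in C^1_{\mathrm{pw}}[-L,L]$ satisfy $a_{\min}\le a\le a_{\max}$, $c_{\min}\le c\le c_{\max}$ with $a_{\min},c_{\min}>0$, and let $-L=z_0<\dots<z_N=L$ be a partition such that on each $\tau_j=(z_{j-1},z_j)$, $a,c$ are $C^1$ on $[z_{j-1},z_j]$ and each of $a',c'$ is either $>0$ throughout $\tau_j$ or $\le 0$ throughout $\tau_j$. Let $f\in L^2(\Omega)$, $g_x\in\mathbb{C}$ ($x\in\Gamma_N$), and let $u\in\mathcal{H}$ satisfy $$\int_{-L}^L\Big(au'\bar v'-\big(\tfrac{\omega}{c}\big)^2u\bar v\Big)-\mathrm{i}\sum_{x\in\Gamma_N}\omega\frac{\sqrt{a(x)}}{c(x)}u(x)\bar v(x)=\int_{-L}^Lf\bar v+\sum_{x\in\Gamma_N}g_x\bar v(x)\quad\forall v\in\mathcal{H}.$$ Let $q$ be real-valued with $q|_{\tau_j}\in C^1(\overline{\tau_j})$ for each $j$, $q=0$ on $\Gamma_D$, and suppose moreover that for each $j=1,\dots,N$ $$\partial_{\mathrm{pw}}\Big(\frac qa\Big)(x)\ge\frac1{a(x)},\qquad \partial_{\mathrm{pw}}\Big(\frac q{c^2}\Big)(x)\ge\frac1{c^2(x)},\qquad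 x\in\tau_j,$$ and that $[q/a]_{z_j}\le0$ and $[q/c^2]_{z_j}\le0$ for $j=1,\dots,N-1$. Then $$\|u\|_{\mathcal{H},a,c}\le C^{\mathrm{I}}_{\mathrm{stab}}Q\|f\|+C^{\mathrm{II}}_{\mathrm{stab}}\sqrt Q\,\|g\|_{\Gamma_N},$$ where $Q=\|q\|_{L^\infty(-L,L)}$, $C^{\mathrm{I}}_{\mathrm{stab}}=\frac{2}{\sqrt{a_{\min}}}\big(1+3\frac{c_{\max}}{c_{\min}}\big)$ and $C^{\mathrm{II}}_{\mathrm{stab}}=\frac2{\sqrt{a_{\min}}}\sqrt{\frac32\frac{c_{\max}}{c_{\min}}+1}$.
   Context: $C^1_{\mathrm{pw}}[-L,L]$ is the set of $g:[-L,L]\to\mathbb{R}$ for which there is a finite partition $-L=z_0<\dots<z_N=L$ with $g\in C^1[z_{j-1},z_j]$ for each $j$ and, on each $(z_{j-1},z_j)$, either $g'>0$ throughout or $g'\le0$ throughout. For the partition, $g^{\pm}(z_j)$ are the right/left one-sided limits, $[g]_{z_j}=g^-(z_j)-g^+(z_j)$ for $1\le j\le N-1$, and $\partial_{\mathrm{pw}}g(x)=g'(x)$ for $x\in(z_{j-1},z_j)$. $\|\cdot\|$ is the $L^2(\Omega)$ norm, $\|v\|^2_{\mathcal{H},a,c}=\|\sqrt a v'\|^2+\|(\omega/c)v\|^2$, and $\|g\|^2_{\Gamma_N}=\sum_{x\in\Gamma_N}|g_x|^2$. *)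

(* Defs.v *)
From HB Require Import structures.
From mathcomp Require Import all_boot all_order all_algebra.
From mathcomp Require Import all_classical all_reals all_analysis.
From mathcomp Require Import complex.

Set Implicit Arguments.
Unset Strict Implicit.
Unset Printing Implicit Defensive.

Import Order.TTheory GRing.Theory Num.Theory.
Import numFieldNormedType.Exports.

Local Open Scope classical_set_scope.
Local Open Scope ring_scope.

Section Defs.
Variable R : realType.

Definition leb := (@lebesgue_measure R).

Definition Omega (L : R) : set R := `]-L, L[.

Definition cabs2 (z : R[i]) : R := complex.Re z ^+ 2 + complex.Im z ^+ 2.

Definition cint (D : set R) (h : R -> R[i]) : R[i] :=
  Complex (Rintegral leb D (fun x => complex.Re (h x)))
          (Rintegral leb D (fun x => complex.Im (h x))).

Definition L2c (D : set R) (h : R -> R[i]) : Prop :=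
  measurable_fun D (fun x => complex.Re (h x)) /\
  measurable_fun D (fun x => complex.Im (h x)) /\
  (\int[leb]_(x in D) (cabs2 (h x))%:E < +oo)%E.

Definition normL2 (D : set R) (h : R -> R[i]) : R :=
  Num.sqrt (Rintegral leb D (fun x => cabs2 (h x))).

(* v in H^1(-L,L) with (weak) derivative dv: v, dv in L^2(-L,L) and v is
   (the absolutely continuous representative) v(x) = v(-L) + int_{-L}^x dv *)
Definition H1 (L : R) (v dv : R -> R[i]) : Prop :=
  L2c (Omega L) v /\ L2c (Omega L) dv /\
  forall x, -L <= x <= L -> v x = v (-L) + cint `[-L, x] dv.

Inductive bcase := BC_NN | BC_DR | BC_DL.

Definition GammaD (L : R) (b : bcase) : seq R :=
  match b with BC_NN => [::] | BC_DR => [:: L] | BC_DL => [:: -L] end.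

Definition GammaN (L : R) (b : bcase) : seq R :=
  match b with BC_NN => [:: -L; L] | BC_DR => [:: -L] | BC_DL => [:: L] end.

Definition inH (L : R) (b : bcase) (v dv : R -> R[i]) : Prop :=
  H1 L v dv /\ forall x, x \in GammaD L b -> v x = 0.

Definition C1_closed (p q : R) (G : R -> R) : Prop :=
  {within `[p, q], continuous G} /\
  (forall x, p < x < q -> derivable G x 1) /\
  exists dG : R -> R, {within `[p, q], continuous dG} /\
    forall x, p < x < q -> derive1 G x = dG x.

Definition is_partition (L : R) (N : nat) (z : nat -> R) : Prop :=
  (0 < N)%N /\ z 0%N = -L /\ z N = L /\
  forall j, (j < N)%N -> z j < z j.+1.

(* g is C^1 on each [z_{j-1}, z_j] (j = 1..N): g coincides on the closed
   subinterval with a C^1 function, except possibly at interior partition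
   points z_1..z_{N-1}, where g may jump. *)
Definition pwC1 (N : nat) (z : nat -> R) (g : R -> R) : Prop :=
  forall j, (0 < j <= N)%N ->
    exists G, C1_closed (z j.-1) (z j) G /\
      forall x, z j.-1 <= x <= z j ->
        (x = z j.-1 -> j = 1%N) -> (x = z j -> j = N) -> g x = G x.

Definition pw_monotone (N : nat) (z : nat -> R) (g : R -> R) : Prop :=
  forall j, (0 < j <= N)%N ->
    (forall x, z j.-1 < x < z j -> 0 < derive1 g x) \/
    (forall x, z j.-1 < x < z j -> derive1 g x <= 0).

Definition jump (g : R -> R) (y : R) : R :=
  lim (g @ at_left y) - lim (g @ at_right y).

Definition Linf_norm (L : R) (q : R -> R) : R :=
  fine (Lnorm leb +oo%E (fun x => (\1_(Omega L) x * q x)%:E)).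

Definition normGN (L : R) (b : bcase) (g : R -> R[i]) : R :=
  Num.sqrt (\sum_(x <- GammaN L b) cabs2 (g x)).

End Defs.

(* Main.v *)
Require Import Defs.
From HB Require Import structures.
From mathcomp Require Import all_boot all_order all_algebra.
From mathcomp Require Import all_classical all_reals all_analysis.
From mathcomp Require Import measurable_realfun ess_sup_inf complex ring lra.

Import Order.TTheory GRing.Theory Num.Theory.
Import numFieldNormedType.Exports.

Local Open Scope classical_set_scope.
Local Open Scope ring_scope.
Local Open Scope complex_scope.

(** The flux [w = a u'] is absolutely continuous with [w' = - f - (omega/c)^2 u]
    (du Bois-Reymond's lemma), and on [Gamma_N] the impedance condition reads
    [w n = i omega sqrt(a)/c u + g].  Hence [E = (q/a)|w|^2 + omega^2 (q/c^2)|u|^2]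
    is absolutely continuous on each piece of the partition, and the two
    hypotheses on [q/a] and [q/c^2] give
    [E' >= |w|^2/a + (omega/c)^2 |u|^2 - 2 Q |f| |w|/a].
    Summing over the pieces, the jumps have the good sign, [q] vanishes on
    [Gamma_D], and the boundary terms on [Gamma_N] are controlled by [g] and by
    the imaginary part of the weak form tested with [u]. *)

(** The weights [q/a] and [q/c^2] are matched to the equation: differentiating [|w|^2] and
    [omega^2 |u|^2] produces the same cross term [Re (u conj w)], with opposite coefficients once
    the weights are applied, so only the derivatives of the weights and a term in [f] survive. As
    [f] is merely square-integrable, [w] need not be differentiable everywhere; a derivative here
    means an integrable function of which the given one is a primitive, and the product rule for
    such pairs is integration by parts, obtained from Fubini. Complex quantities are split into real
    and imaginary parts throughout, which are coupled only through the impedance condition. At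
    interior partition points the values of [a], [c], [q] may differ from both one-sided limits, so
    each piece works with C^1 representatives on the closed interval and only limits enter the
    energy balance. With [E] the norm of [u], everything ends in [E^2 <= X E + Y^2], hence
    [E <= X + Y]: [X] collects the contributions of [f] and yields the first constant, [Y^2] those
    of [g], which explains the square roots in the second. *)

Section RealAnalysis.
Set Implicit Arguments.
Unset Strict Implicit.
Unset Printing Implicit Defensive.
Context {R : realType}.
Notation mu := (@lebesgue_measure R).
Local Notation RT := (measurableTypeR R).
Local Notation meas D := (@measurable _ RT D).
Local Notation mfun D f := (@measurable_fun _ _ RT R D f).
Notation intble D f := (mu.-integrable D (EFin \o f)).
Implicit Types (f g h F G : R -> R) (D : set RT) (s t x : R).

(** * Integrability and measurability on intervals *)

Lemma intbleD D f g : meas D -> intble D f -> intble D g ->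
  intble D (fun x => f x + g x).
Proof. by move=> mD; exact: integrableD. Qed.

Lemma intbleB D f g : meas D -> intble D f -> intble D g ->
  intble D (fun x => f x - g x).
Proof. by move=> mD; exact: integrableB. Qed.

Lemma intbleZ D k f : meas D -> intble D f -> intble D (fun x => k * f x).
Proof.
move=> mD fi; apply: (eq_integrable mD _ _ _ (integrableZl mD k fi)) => x _.
by rewrite /= EFinM.
Qed.

Lemma intble_measurable {D f} : intble D f -> mfun D f.
Proof. by move=> /measurable_int/measurable_EFinP. Qed.

Lemma intble_eq D f g : meas D -> {in D, f =1 g} -> intble D f -> intble D g.
Proof.
move=> mD fg; by apply: eq_integrable => // x Dx /=; rewrite fg.
Qed.

Lemma intble_le D f g : meas D -> mfun D f ->
  (forall x, D x -> `|f x| <= g x) -> intble D g -> intble D f.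
Proof.
move=> mD mf fg; apply: le_integrable => //; first exact/measurable_EFinP.
by move=> x Dx /=; rewrite lee_fin (le_trans (fg x Dx))// ler_norm.
Qed.

Lemma intble_bM D h f (M : R) : meas D -> mfun D h ->
  (forall x, D x -> `|h x| <= M) -> intble D f -> intble D (fun x => h x * f x).
Proof.
move=> mD mh hM fi; apply: (@intble_le _ _ (fun x => M * `|f x|)) => //.
- by apply: measurable_funM => //; exact: intble_measurable.
- by move=> x Dx; rewrite normrM ler_wpM2r// hM.
- by apply: intbleZ => //; exact: integrable_norm.
Qed.

Lemma intbleS D D' f : meas D -> meas D' -> D' `<=` D ->
  intble D f -> intble D' f.
Proof. by move=> mD mD' DD'; exact: integrableS. Qed.

Lemma measurable_itv_oocc s t f : mfun `]s, t[ f -> mfun `[s, t] f.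
Proof.
move=> mf; apply/measurable_fun_itv_obnd_cbndP.
by apply/measurable_fun_itv_bndo_bndcP.
Qed.

Lemma integral_itv_oocc s t f : mfun `]s, t[ f ->
  \int[mu]_(x in `[s, t]) f x = \int[mu]_(x in `]s, t[) f x.
Proof.
by move=> mf; rewrite /Rintegral integral_itv_bndoo//; exact/measurable_EFinP.
Qed.

Lemma intble_itv_oocc s t f : intble `]s, t[ f -> intble `[s, t] f.
Proof.
move=> fi; have mf := intble_measurable fi.
apply/integrableP; split.
  by apply/measurable_EFinP; exact: measurable_itv_oocc.
rewrite integral_itv_bndoo//; first by case/integrableP: fi.
by apply/measurableT_comp => //; exact/measurable_EFinP.
Qed.

Lemma within_continuous_bounded s t f : {within `[s, t], continuous f} ->
  exists M, forall x, s <= x <= t -> `|f x| <= M.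
Proof.
move=> cf; have [st|ts] := leP s t; last first.
  by exists 0 => x /andP[sx xt]; have := le_lt_trans (le_trans sx xt) ts; rewrite ltxx.
have : bounded_set (f @` `[s, t]).
  apply: compact_bounded; apply: continuous_compact => //; exact: segment_compact.
move=> [M [_ Mf]]; exists (M + 1) => x xst; apply: (Mf (M + 1)); first by rewrite ltrDl.
by exists x => //=; rewrite in_itv.
Qed.

Lemma within_continuous_measurable s t f : {within `[s, t], continuous f} ->
  mfun `[s, t] f.
Proof. by move=> cf; apply: subspace_continuous_measurable_fun. Qed.

(** [F] is absolutely continuous on [[s, t]] with a.e. derivative [f]. *)
Definition AC s t F f := intble `[s, t] f /\
  forall x, s <= x <= t -> F x = F s + \int[mu]_(y in `[s, x]) f y.

(** * Calculus of absolutely continuous functions *)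

Section ACtheory.
Variables (s t : R).
Hypothesis st : s <= t.

Lemma AC_continuous F f : AC s t F f -> {within `[s, t], continuous F}.
Proof.
move=> [fi Ff]; have := parameterized_integral_continuous st fi => cp.
have : {within `[s, t], continuous (fun x => F s + \int[mu]_(y in `[s, x]) f y)}.
  move=> x; apply: (@continuousD _ _ (subspace `[s, t]) (cst (F s))).
    exact: cst_continuous.
  exact: cp.
apply: subspace_eq_continuous => x; rewrite inE/= in_itv/= => xst.
exact/esym/Ff.
Qed.

Lemma AC_measurable F f : AC s t F f -> mfun `[s, t] F.
Proof. by move=> /AC_continuous/within_continuous_measurable. Qed.

Lemma AC_bounded F f : AC s t F f -> exists M, forall x, s <= x <= t -> `|F x| <= M.
Proof. by move=> /AC_continuous/within_continuous_bounded. Qed.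

Lemma AC_intbleM F f g : AC s t F f -> intble `[s, t] g ->
  intble `[s, t] (fun x => F x * g x).
Proof.
move=> AF gi; have [M FM] := AC_bounded AF; apply: (@intble_bM _ _ _ M) => //.
exact: AC_measurable AF.
Qed.

Lemma AC_ftc F f : AC s t F f -> \int[mu]_(x in `[s, t]) f x = F t - F s.
Proof. by move=> [_ /(_ t)]; rewrite st lexx => /(_ isT) ->; rewrite addrAC subrr add0r. Qed.

End ACtheory.

Lemma AC_primitive s t k f : intble `[s, t] f ->
  AC s t (fun x => k + \int[mu]_(y in `[s, x]) f y) f.
Proof.
by move=> fi; split => // x _; rewrite set_itv1 Rintegral_set1 addr0.
Qed.

Lemma itvccS s t x y : s <= x -> y <= t -> `[x, y] `<=` `[s, t].
Proof. by move=> sx yt; apply: subset_itv; rewrite bnd_simp. Qed.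

Lemma AC_sub s t F f x y : s <= x -> x <= y -> y <= t -> AC s t F f -> AC x y F f.
Proof.
move=> sx xy yt [fi Ff]; split.
  by apply: intbleS fi => //; exact: itvccS.
move=> r /andP[xr ry].
have rt := le_trans ry yt; have sr := le_trans sx xr; have xt := le_trans xr rt.
rewrite (Ff r) ?sr// (Ff x) ?sx// -addrA; congr (_ + _).
have fir : intble `[s, r] f by apply: intbleS fi => //; exact: itvccS.
have := @Rintegral_itvB _ f (BLeft s) (BRight r) x fir.
rewrite !bnd_simp => /(_ sx xr) /(canRL (subrK _)) ->.
rewrite addrC; congr (_ + _).
apply: Rintegral_itv_obnd_cbnd.
by apply: intbleS fir => //; apply: subset_itv; rewrite bnd_simp.
Qed.

Lemma lebesgue_aeS (P Q : RT -> Prop) : (forall x, P x -> Q x) ->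
  {ae mu, forall x, P x} -> {ae mu, forall x, Q x}.
Proof. exact: (@filterS _ _ (ae_filter_ringOfSetsType mu)). Qed.

(** Serves to trade [Re u'] and [Im u'] for [wr / a] and [wi / a], with which they agree only almost
    everywhere. Measurability of [g] is a separate hypothesis because Borel measurability is not
    stable under modification on a null set. *)
Lemma AC_ae s t F f g : AC s t F f -> mfun `[s, t] g ->
  {ae mu, forall x : RT, s <= x <= t -> f x = g x} -> AC s t F g.
Proof.
move=> [fi Ff] mg fg.
have mf := intble_measurable fi.
split.
  apply/integrableP; split; first exact/measurable_EFinP.
  case/integrableP: fi => _; apply: le_lt_trans.
  rewrite le_eqVlt; apply/orP; left; apply/eqP; apply: ae_eq_integral => //.
  - by apply/measurableT_comp => //; exact/measurable_EFinP.
  - by apply/measurableT_comp => //; exact/measurable_EFinP.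
  - by apply: lebesgue_aeS fg => x fg; rewrite /= in_itv/= => /fg ->.
move=> x xst; rewrite (Ff x xst); congr (_ + fine _).
have S : `[s, x] `<=` `[s, t] by apply: itvccS => //; case/andP: xst.
apply: ae_eq_integral => //.
- by apply/measurable_EFinP; apply: measurable_funS S _.
- by apply/measurable_EFinP; apply: measurable_funS S _.
- by apply: lebesgue_aeS fg => y fg /S; rewrite /= in_itv/= => /fg ->.
Qed.

Lemma AC_eq s t F G f g : s <= t -> (forall x, s <= x <= t -> F x = G x) ->
  {in `[s, t]%classic, f =1 g} -> AC s t F f -> AC s t G g.
Proof.
move=> st FG fg [fi Ff]; split; first exact: intble_eq fg fi.
move=> x xst; rewrite -!FG ?lexx// (Ff x xst); congr (_ + _).
apply: eq_Rintegral => y; rewrite inE/= => yx; apply: fg; rewrite inE/=.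
by apply: itvccS yx => //; case/andP: xst.
Qed.

Lemma AC_add s t F G f g : AC s t F f -> AC s t G g ->
  AC s t (fun x => F x + G x) (fun x => f x + g x).
Proof.
move=> [fi Ff] [gi Gg]; split; first exact: intbleD.
move=> x xst; have S : `[s, x] `<=` `[s, t] by apply: itvccS => //; case/andP: xst.
rewrite (Ff x xst) (Gg x xst) RintegralD//; first by rewrite addrACA.
- by apply: intbleS S fi.
- by apply: intbleS S gi.
Qed.

Lemma AC_scale s t k F f : AC s t F f ->
  AC s t (fun x => k * F x) (fun x => k * f x).
Proof.
move=> [fi Ff]; split; first exact: intbleZ.
move=> x xst; have S : `[s, x] `<=` `[s, t] by apply: itvccS => //; case/andP: xst.
by rewrite (Ff x xst) RintegralZl// ?mulrDr//; apply: intbleS S fi.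
Qed.

Lemma AC_cst s t k : AC s t (cst k) (cst 0).
Proof.
split; first exact: integrable0.
by move=> x _; rewrite Rintegral_cst//= mul0r addr0.
Qed.

Lemma intble_patch D f : meas D -> intble D f -> intble setT (f \_ D).
Proof.
by move=> mD fi; have := (@integrable_mkcond _ RT R mu D _ mD).1 fi; rewrite restrict_EFin.
Qed.

(** * Integration by parts through Fubini's theorem *)

Section Fubini.
Variables (s t : R) (f g : R -> R).
Hypotheses (st : s <= t) (fi : intble `[s, t] f) (gi : intble `[s, t] g).

Let f0 : RT -> R := f \_ `[s, t].
Let g0 : RT -> R := g \_ `[s, t].
(* Fubini's theorem is applied to [f x * g y] on the triangle [s <= x <= y <= t]. *)
Let e (x y : R) : R := ((x <= y)%R : bool)%:R.
Let k (p : RT * RT) : R := f0 p.1 * (g0 p.2 * e p.1 p.2).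

Let f0i : intble setT f0.
Proof. exact: intble_patch. Qed.

Let g0i : intble setT g0.
Proof. exact: intble_patch. Qed.

Let mf0 := intble_measurable f0i.
Let mg0 := intble_measurable g0i.

Let me : measurable_fun setT (fun p : RT * RT => e p.1 p.2).
Proof.
apply: (@measurableT_comp _ _ _ _ _ _ (fun b : bool => b%:R : R)) => //.
apply: measurable_fun_ler.
  exact: (@measurable_fst _ _ RT RT).
exact: (@measurable_snd _ _ RT RT).
Qed.

Let mk : measurable_fun setT (EFin \o k).
Proof.
apply/measurable_EFinP; apply: measurable_funM.
  exact: (measurableT_comp mf0 (@measurable_fst _ _ RT RT)).
apply: measurable_funM => //.
exact: (measurableT_comp mg0 (@measurable_snd _ _ RT RT)).
Qed.

Let k_row x : intble setT (fun y => k (x, y)).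
Proof.
apply: (@intbleZ _ (f0 x) (fun y => g0 y * e x y)) => //.
apply: (@intble_le _ _ (fun y => `|g0 y|)) => //.
- apply: measurable_funM => //.
  exact: (measurableT_comp me (pair1_measurable x)).
- by move=> y _; rewrite normrM /e; case: (x <= y); rewrite /= ?normr1 ?normr0 ?mulr1 ?mulr0.
- exact: integrable_norm.
Qed.

Let k_col y : intble setT (fun x => k (x, y)).
Proof.
rewrite (_ : (fun x => _) = (fun x => g0 y * (f0 x * e x y))); last first.
  by apply/funext => x; rewrite /k /=; ring.
apply: (@intbleZ _ (g0 y) (fun x => f0 x * e x y)) => //.
apply: (@intble_le _ _ (fun y => `|f0 y|)) => //.
- apply: measurable_funM => //.
  exact: (measurableT_comp me (pair2_measurable y)).
- by move=> x _; rewrite normrM /e; case: (x <= y); rewrite /= ?normr1 ?normr0 ?mulr1 ?mulr0.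
- exact: integrable_norm.
Qed.

(** Dominated by [|f0 x| |g0 y|], whose iterated integral is the product of two finite L^1 norms. *)
Let ki : (mu \x mu)%E.-integrable setT (EFin \o k).
Proof.
apply/integrable12ltyP => //.
apply: (@le_lt_trans _ _ (\int[mu]_x (`|f0 x|%:E * (\int[mu]_y `|g0 y|%:E)))%E).
  apply: ge0_le_integral => //.
  - by move=> x _; exact: integral_ge0.
  - apply: (measurable_fun_fubini_tonelli_F (fun p => `|(EFin \o k) p|)%E) => //.
    exact: measurableT_comp.
  - apply: emeasurable_funM => //.
    by apply/measurable_EFinP; exact: measurableT_comp.
  move=> x _; rewrite -ge0_integralZl//.
  - apply: ge0_le_integral => //.
    + by apply: measurableT_comp => //; exact: measurable_int (k_row x).
    + apply: emeasurable_funM => //.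
      by apply/measurable_EFinP; exact: measurableT_comp.
    + move=> y _; rewrite /= /k /= !normrM -EFinM lee_fin ler_wpM2l//.
      by rewrite /e; case: (x <= y); rewrite /= ?normr1 ?normr0 ?mulr1 ?mulr0.
  - by apply/measurable_EFinP; exact: measurableT_comp.
case/integrableP: g0i => _ /= G; case/integrableP: f0i => _ /= F.
have G0 : (0 <= \int[mu]_y `|g0 y|%:E)%E by exact: integral_ge0.
have F0 : (0 <= \int[mu]_y `|f0 y|%:E)%E by exact: integral_ge0.
rewrite ge0_integralZr//.
  by rewrite lte_mul_pinfty// ge0_fin_numE.
by apply/measurable_EFinP; exact: measurableT_comp.
Qed.

Let rowE x : (\int[mu]_y (k (x, y))%:E =
  ((fun x => f x * \int[mu]_(y in `[x, t]) g y) \_ `[s, t] x)%:E)%E.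
Proof.
rewrite -[LHS]fineK; last exact: integrable_fin_num (k_row x).
congr EFin; rewrite -[LHS]/(Rintegral mu setT (fun y => k (x, y))).
rewrite /k /= /f0 !patchE; case: ifPn => [|_]; last first.
  by under eq_Rintegral do rewrite mul0r; rewrite Rintegral_cst// !mul0r.
rewrite inE/= in_itv/= => /andP[sx xt].
have E : (fun y => g0 y * e x y) = g \_ `[x, t].
  apply/funext => y; rewrite /g0 !patchE /e !mem_setE !in_itv/=.
  case: (leP x y) => xy; rewrite ?mulr1 ?mulr0 ?(le_trans sx xy)//=.
have Ei : intble setT (g \_ `[x, t]).
  by apply: intble_patch => //; apply: intbleS gi => //; exact: itvccS.
rewrite [in RHS]Rintegral_mkcond -RintegralZl//.
by apply: eq_Rintegral => y _; rewrite -[in RHS]E.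
Qed.

Let colE y : (\int[mu]_x (k (x, y))%:E =
  ((fun y => g y * \int[mu]_(x in `[s, y]) f x) \_ `[s, t] y)%:E)%E.
Proof.
rewrite -[LHS]fineK; last exact: integrable_fin_num (k_col y).
congr EFin; rewrite -[LHS]/(Rintegral mu setT (fun x => k (x, y))).
rewrite /k /= /g0 !patchE; case: ifPn => [|_]; last first.
  by under eq_Rintegral do rewrite mul0r mulr0; rewrite Rintegral_cst// mul0r.
rewrite inE/= in_itv/= => /andP[sy yt].
have E : (fun x => f0 x * e x y) = f \_ `[s, y].
  apply/funext => x; rewrite /f0 !patchE /e !mem_setE !in_itv/=.
  case: (leP x y) => xy; rewrite ?mulr1 ?mulr0 ?(le_trans xy yt)//= ?andbT ?andbF//.
have Ei : intble setT (f \_ `[s, y]).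
  by apply: intble_patch => //; apply: intbleS fi => //; exact: itvccS.
rewrite [in RHS]Rintegral_mkcond -RintegralZl//.
by apply: eq_Rintegral => x _; rewrite -[in RHS]E; ring.
Qed.

Let swap : \int[mu]_(x in `[s, t]) (f x * \int[mu]_(y in `[x, t]) g y) =
  \int[mu]_(y in `[s, t]) (g y * \int[mu]_(x in `[s, y]) f x).
Proof.
have := Fubini ki; under eq_integral do rewrite rowE.
under [in X in _ = X -> _]eq_integral do rewrite colE.
by move=> /(congr1 fine) E; rewrite Rintegral_mkcond [RHS]Rintegral_mkcond.
Qed.

(** By [swap], the second summand integrates to the integral of [f x] times the integral of [g] over
    [[x, t]]; together with the first summand, the integrals of [g] over [[s, x]] and [[x, t]] add
    up to the full one, a constant. *)
Lemma Rintegral_parts :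
  \int[mu]_(x in `[s, t]) (f x * \int[mu]_(y in `[s, x]) g y
    + (\int[mu]_(y in `[s, x]) f y) * g x) =
  (\int[mu]_(x in `[s, t]) f x) * \int[mu]_(x in `[s, t]) g x.
Proof.
have Af := AC_primitive 0 fi; have Ag := AC_primitive 0 gi.
have If := AC_intbleM st Ag fi; have Ig := AC_intbleM st Af gi.
have Ifg : intble `[s, t] (fun x => f x * \int[mu]_(y in `[s, x]) g y).
  by apply: intble_eq If => // x _ /=; ring.
have Igf : intble `[s, t] (fun x => (\int[mu]_(y in `[s, x]) f y) * g x).
  by apply: intble_eq Ig => // x _ /=; ring.
rewrite RintegralD//.
have -> : \int[mu]_(x in `[s, t]) ((\int[mu]_(y in `[s, x]) f y) * g x) =
    \int[mu]_(x in `[s, t]) (f x * \int[mu]_(y in `[x, t]) g y).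
  by rewrite swap; apply: eq_Rintegral => x _; ring.
have -> : \int[mu]_(x in `[s, t]) (f x * \int[mu]_(y in `[x, t]) g y) =
    \int[mu]_(x in `[s, t]) (f x * (\int[mu]_(y in `[s, t]) g y) -
                              f x * \int[mu]_(y in `[s, x]) g y).
  apply: eq_Rintegral => x; rewrite inE/= in_itv/= => /andP[sx xt].
  rewrite -mulrBr; congr (_ * _).
  rewrite Rintegral_itvB ?bnd_simp// Rintegral_itv_obnd_cbnd//.
  by apply: intbleS gi => //; apply: subset_itv; rewrite bnd_simp.
rewrite RintegralB//; last first.
  apply: intble_eq (intbleZ (\int[mu]_(y in `[s, t]) g y) _ fi) => // x _ /=; ring.
by rewrite RintegralZr// addrCA subrr addr0.
Qed.

End Fubini.

(** Writing each function as its value at [s] plus a primitive, the constants contribute linear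
    terms and the product of the two primitives is [Rintegral_parts] on [[s, x]]. *)
Lemma AC_mul s t F G f g : s <= t -> AC s t F f -> AC s t G g ->
  AC s t (fun x => F x * G x) (fun x => f x * G x + F x * g x).
Proof.
move=> st AF AG; have [fi Ff] := AF; have [gi Gg] := AG.
have If := AC_intbleM st AG fi; have Ig := AC_intbleM st AF gi.
have If' : intble `[s, t] (fun x => f x * G x).
  by apply: intble_eq If => // x _ /=; ring.
split; first exact: intbleD.
move=> x /andP[sx xt].
have [fi' Ff'] := AC_sub (lexx s) sx xt AF.
have [gi' Gg'] := AC_sub (lexx s) sx xt AG.
have -> : \int[mu]_(y in `[s, x]) (f y * G y + F y * g y) =
  \int[mu]_(y in `[s, x]) ((G s * f y + F s * g y) +
    (f y * \int[mu]_(r in `[s, y]) g r + (\int[mu]_(r in `[s, y]) f r) * g y)).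
  apply: eq_Rintegral => y; rewrite inE/= in_itv/= => yx.
  by rewrite (Ff' y)// (Gg' y)//; ring.
have Af := AC_primitive 0 fi'; have Ag := AC_primitive 0 gi'.
have I1 : intble `[s, x] (fun y => f y * \int[mu]_(r in `[s, y]) g r).
  by apply: intble_eq (AC_intbleM sx Ag fi') => // y _ /=; ring.
have I2 : intble `[s, x] (fun y => (\int[mu]_(r in `[s, y]) f r) * g y).
  by apply: intble_eq (AC_intbleM sx Af gi') => // y _ /=; ring.
have I3 := intbleZ (G s) (measurable_itv _) fi'.
have I4 := intbleZ (F s) (measurable_itv _) gi'.
rewrite RintegralD//; [|exact: intbleD|exact: intbleD].
rewrite Rintegral_parts// RintegralD// !RintegralZl//.
rewrite (Ff' x) ?sx ?lexx// (Gg' x) ?sx ?lexx//; ring.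
Qed.

(** * Square-integrable functions *)

Definition L2 D f := mfun D f /\ intble D (fun x => f x ^+ 2).

Section L2theory.
Variables (D : set RT).
Hypothesis mD : meas D.

Lemma L2_mul f g : L2 D f -> L2 D g -> intble D (fun x => f x * g x).
Proof.
move=> [mf fi] [mg gi]; apply: (@intble_le _ _ (fun x => f x ^+ 2 + g x ^+ 2)) => //.
- exact: measurable_funM.
- move=> x _; rewrite normrM -[f x ^+ 2]real_normK ?num_real// -[g x ^+ 2]real_normK ?num_real//.
  have := sqr_ge0 (`|f x| - `|g x|); have := mulr_ge0 (normr_ge0 (f x)) (normr_ge0 (g x)).
  by nra.
- exact: intbleD.
Qed.

Lemma L2_add f g : L2 D f -> L2 D g -> L2 D (fun x => f x + g x).
Proof.
move=> Lf Lg; split.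
  by apply: measurable_funD; [case: Lf|case: Lg].
have := intbleD mD (intbleD mD Lf.2 Lg.2) (intbleZ 2 mD (L2_mul Lf Lg)).
by apply: intble_eq => // x _; ring.
Qed.

Lemma L2_bM f k M : mfun D k -> (forall x, D x -> `|k x| <= M) ->
  L2 D f -> L2 D (fun x => k x * f x).
Proof.
move=> mk kM [mf fi]; split; first exact: measurable_funM.
have : intble D (fun x => k x ^+ 2 * f x ^+ 2).
  apply: (@intble_bM _ _ _ (M ^+ 2)) => //.
    by apply: measurable_funX.
  move=> x Dx; rewrite normrX; apply: lerXn2r; rewrite ?nnegrE ?kM//.
  exact: le_trans (normr_ge0 _) (kM x Dx).
by apply: intble_eq => // x _; ring.
Qed.

Lemma Rintegral_cauchy_schwarz f g : L2 D f -> L2 D g ->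
  \int[mu]_(x in D) (f x * g x) <=
  Num.sqrt (\int[mu]_(x in D) (f x ^+ 2)) * Num.sqrt (\int[mu]_(x in D) (g x ^+ 2)).
Proof.
move=> Lf Lg; set A := \int[mu]_(x in D) (f x ^+ 2); set B := \int[mu]_(x in D) (g x ^+ 2).
set I := \int[mu]_(x in D) (f x * g x).
have A0 : 0 <= A by apply: Rintegral_ge0 => x _; exact: sqr_ge0.
have B0 : 0 <= B by apply: Rintegral_ge0 => x _; exact: sqr_ge0.
have fgi := L2_mul Lf Lg.
have disc r : 0 <= r ^+ 2 * A + (- (2 * r) * I + B).
  have -> : r ^+ 2 * A + (- (2 * r) * I + B) =
      \int[mu]_(x in D) ((r * f x - g x) ^+ 2).
    rewrite -RintegralZl ?Lf.2// -RintegralZl// -RintegralD ?Lg.2//; last exact: intbleZ.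
    rewrite -RintegralD//; last 2 first.
    - by apply: intbleZ => //; exact: Lf.2.
    - by apply: intbleD => //; [exact: intbleZ|exact: Lg.2].
    by apply: eq_Rintegral => x _; ring.
  by apply: Rintegral_ge0 => x _; exact: sqr_ge0.
have IAB : I ^+ 2 <= A * B.
  have [A0'|A0'] := eqVneq A 0.
    have [->|I0] := eqVneq I 0; first by rewrite expr0n mulr_ge0.
    (* With [A = 0] the quadratic [disc] is affine in [r]; this [r] is chosen so that it takes the
       value [-1]. *)
    have := disc ((B + 1) / (2 * I)); rewrite A0'.
    have -> : (- (2 * ((B + 1) / (2 * I))) * I + B) = -1 by field.
    by rewrite mulr0 add0r ler0N1.
  have Ap : 0 < A by rewrite lt_def A0'.
  (* The minimiser of the quadratic. *)
  have := disc (I / A).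
  have -> : (I / A) ^+ 2 * A + (- (2 * (I / A)) * I + B) = (A * B - I ^+ 2) / A by field.
  by rewrite pmulr_lge0 ?invr_gt0// subr_ge0.
rewrite -sqrtrM// (le_trans (ler_norm I))// -sqrtr_sqr ler_sqrt//.
exact: mulr_ge0.
Qed.

End L2theory.

Lemma L2_bounded s t f M : mfun `]s, t[ f -> (forall x, s < x < t -> `|f x| <= M) ->
  L2 `]s, t[ f.
Proof.
move=> mf fM; split => //; apply: measurable_bounded_integrable => //.
- by rewrite /= lebesgue_measure_itv/= lte_fin; case: ifP => _ //; rewrite -EFinD ltry.
- exact: measurable_funX.
exists (M ^+ 2); split; first exact: num_real.
move=> y My x /=; rewrite in_itv/= => xst; rewrite (le_trans _ (ltW My))//.
rewrite normrX; apply: lerXn2r; rewrite ?nnegrE ?fM//.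
exact: le_trans (normr_ge0 _) (fM x xst).
Qed.

Lemma L2_intble s t f : L2 `]s, t[ f -> intble `[s, t] f.
Proof.
move=> Lf; apply: intble_itv_oocc.
have L1 : L2 `]s, t[ (cst 1) by apply: (@L2_bounded _ _ _ 1) => // x _; rewrite normr1.
by apply: intble_eq (L2_mul _ L1 Lf) => // x _; rewrite mul1r.
Qed.

Lemma AC_L2 s t F f : s <= t -> AC s t F f -> L2 `]s, t[ F.
Proof.
move=> st AF; have [M FM] := AC_bounded st AF.
apply: (@L2_bounded _ _ _ M).
  by apply: measurable_funS (AC_measurable st AF) => //; exact: subset_itv_oo_cc.
by move=> x /andP[/ltW sx /ltW xt]; apply: FM; rewrite sx.
Qed.

(** * Du Bois-Reymond's lemma *)

Lemma Rintegral_sqr_eq0 s t f : L2 `]s, t[ f -> \int[mu]_(x in `]s, t[) (f x ^+ 2) = 0 ->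
  {ae mu, forall x : RT, s < x < t -> f x = 0}.
Proof.
move=> [mf fi] f0.
have mf2 : measurable_fun (`]s, t[ : set RT) (fun x => (f x ^+ 2)%:E).
  by apply/measurable_EFinP; exact: measurable_funX.
have H := (@ae_eq_integral_abs _ RT R mu `]s, t[ (measurable_itv _) _ mf2).1.
have /H : (\int[mu]_(x in `]s, t[) `|(f x ^+ 2)%:E| = 0)%E.
  under eq_integral do rewrite gee0_abs ?lee_fin ?sqr_ge0//.
  rewrite -[LHS]fineK; first by rewrite -[fine _]/(Rintegral mu _ _) f0.
  exact: integrable_fin_num fi.
apply: lebesgue_aeS => x; rewrite /= in_itv/= => /[apply] -[] /eqP.
by rewrite sqrf_eq0 => /eqP.
Qed.

(** Real-valued test functions are enough: the real and the imaginary part of the weak form, tested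
    with them, are two real weak forms of the same shape. *)
Definition real_test L b v dv := [/\ L2 `]-L, L[ v, L2 `]-L, L[ dv, AC (-L) L v dv &
  forall x, x \in GammaD L b -> v x = 0].

Section duBoisReymond.
Variables (L : R) (b : bcase) (d h T : R -> R).
Hypotheses (L0 : 0 < L) (Ld : L2 `]-L, L[ d) (Lh : L2 `]-L, L[ h).
Hypothesis weak : forall v dv, real_test L b v dv ->
  \int[mu]_(x in `]-L, L[) (d x * dv x - h x * v x) = \sum_(x <- GammaN L b) T x * v x.

Let LL : - L <= L. Proof. by rewrite ge0_cp// ltW. Qed.
Let H x := 0 + \int[mu]_(y in `[-L, x]) h y.
Let AH : AC (-L) L H h. Proof. by apply: AC_primitive; exact: L2_intble. Qed.
Let LH : L2 `]-L, L[ H. Proof. exact: AC_L2 AH. Qed.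
Let H0 : H (-L) = 0. Proof. by rewrite /H set_itv1 Rintegral_set1 addr0. Qed.

(** Since [H v] is absolutely continuous and [H (-L) = 0], the term [h v] moves onto [dv], at the
    price of a boundary term at [L] only. *)
Let parts v dv : real_test L b v dv ->
  \int[mu]_(x in `]-L, L[) ((d x + H x) * dv x) =
  H L * v L + \sum_(x <- GammaN L b) T x * v x.
Proof.
move=> vt; rewrite -(weak vt); have [Lv Ldv Av _] := vt.
have := AC_ftc LL (AC_mul LL AH Av); rewrite H0 mul0r subr0 => <-.
have I1 : intble `]-L, L[ (fun x => h x * v x + H x * dv x).
  by apply: intbleD => //; exact: L2_mul.
rewrite integral_itv_oocc; last exact: intble_measurable I1.
rewrite -RintegralD//; last by apply: intbleB => //; exact: L2_mul.
by apply: eq_Rintegral => x _; ring.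
Qed.

(** By [parts], [d + H] is orthogonal, up to boundary terms, to all admissible derivatives, so it is
    a constant [K] almost everywhere and [w = K - H]. The sign of [T (-L)] is that of the outward
    normal. *)
Lemma du_bois_reymond : exists w, [/\ AC (-L) L w (fun x => - h x),
  {ae mu, forall x : RT, -L < x < L -> d x = w x},
  -L \in GammaN L b -> w (-L) = - T (-L) & L \in GammaN L b -> w L = T L].
Proof.
have NL : (-L == L) = false.
  by apply/negbTE; rewrite lt_eqF// gt0_cp.
(* With no Dirichlet end the constant 1 is admissible; it gives the compatibility condition under
   which the two ends prescribe the same [K]. *)
have test1 : b = BC_NN -> H L + T (-L) + T L = 0.
  move=> bE; have t1 : real_test L b (cst 1) (cst 0).
    split; last by rewrite bE.
    - by apply: (@L2_bounded _ _ _ 1) => // x _; rewrite normr1.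
    - by apply: (@L2_bounded _ _ _ 0) => // x _; rewrite normr0.
    - exact: AC_cst.
  have := parts t1; under eq_Rintegral do rewrite mulr0.
  rewrite Rintegral_cst// mul0r bE !big_cons big_nil /=; lra.
(* [d + H - K] is used as the derivative of a test function, with [K] the only
   candidate for the value of the flux [d + H] that the boundary terms allow. *)
pose K := if b is BC_DL then H L + T L else - T (-L).
pose D0 x := d x + H x + - K.
have LD0 : L2 `]-L, L[ D0.
  apply: L2_add => //; first exact: L2_add.
  exact: (@L2_bounded _ _ _ `|-K|).
(* The initial value makes [v] vanish at the Dirichlet end: minus the total integral of [D0] if that
   end is [L], and 0 if it is [-L]. *)
pose v0 := if b is BC_DR then - \int[mu]_(y in `[-L, L]) D0 y else 0.
pose v x := v0 + \int[mu]_(y in `[-L, x]) D0 y.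
have Av : AC (-L) L v D0 by apply: AC_primitive; exact: L2_intble.
have vN : v (-L) = v0 by rewrite /v set_itv1 Rintegral_set1 addr0.
have vt : real_test L b v D0.
  split => //; first exact: AC_L2 Av.
  move=> x; rewrite /v /v0; case: (b) => //=; rewrite inE => /eqP ->.
    by rewrite addNr.
  by rewrite set_itv1 Rintegral_set1 addr0.
have D0int : \int[mu]_(x in `]-L, L[) D0 x = v L - v (-L).
  by rewrite -(AC_ftc LL Av) integral_itv_oocc//; case: LD0.
have D2 : \int[mu]_(x in `]-L, L[) (D0 x ^+ 2) = 0.
  have LDi : intble `]-L, L[ D0.
    by apply: intbleS (L2_intble LD0) => //; exact: subset_itv_oo_cc.
  (* Here [D0 ^+ 2] is split as [(d + H) D0 - K D0]: [parts] evaluates the first integral, [D0int]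
     the second, and the boundary terms cancel by the choice of [K]. *)
  transitivity (\int[mu]_(x in `]-L, L[) ((d x + H x) * D0 x) -
      K * \int[mu]_(x in `]-L, L[) D0 x).
    rewrite -RintegralZl// -RintegralB//; last exact: intbleZ.
      by apply: eq_Rintegral => x _; rewrite /D0; ring.
    by apply: L2_mul => //; exact: L2_add.
  rewrite (parts vt) D0int.
  case: vt => _ _ _; move: test1 vN; rewrite /K /v0; case: (b) => t1 vN vD.
  - by rewrite !big_cons big_nil vN; have := t1 erefl; nra.
  - rewrite big_cons big_nil (vD L) ?inE//; ring.
  - rewrite big_cons big_nil (vD (-L)) ?inE//; ring.
exists (fun x => K + (-1) * H x); split.
- have := AC_add (AC_cst (-L) L K) (AC_scale (-1) AH).
  by apply: AC_eq => // x _ /=; ring.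
- apply: lebesgue_aeS (Rintegral_sqr_eq0 LD0 D2) => x /[apply]; rewrite /D0; lra.
- rewrite H0 mulr0 addr0 /K; case: (b) => //.
  by rewrite inE NL.
- move: test1; rewrite /K; case: (b) => //; rewrite ?inE.
  + by move=> /(_ erefl); lra.
  + by rewrite eq_sym NL.
  + by move=> _ _; ring.
Qed.

End duBoisReymond.

(** * C^1 functions on a closed interval *)

Lemma within_subitv s t x y G : s <= x -> y <= t -> {within `[s, t], continuous G} ->
  {within `[x, y], continuous G}.
Proof. by move=> sx yt; apply: continuous_subspaceW; exact: itvccS. Qed.

Lemma C1_AC s t G : s < t -> C1_closed s t G ->
  exists2 dG, AC s t G dG & forall x, s < x < t -> dG x = derive1 G x.
Proof.
move=> st [cG [dG [g [cg gE]]]]; exists g; last by move=> x xst; rewrite gE.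
split.
  by apply: continuous_compact_integrable => //; exact: segment_compact.
move=> x /andP[]; rewrite le_eqVlt => /predU1P[<- _|sx xt].
  by rewrite set_itv1 Rintegral_set1 addr0.
have cGx := within_subitv (lexx s) xt cG; have cgx := within_subitv (lexx s) xt cg.
rewrite /Rintegral (continuous_FTC2 sx cgx (F := G)).
- by rewrite -EFinB/= addrC subrK.
- have [_ c1 c2] := (continuous_within_itvP _ sx).1 cGx.
  split => // y; rewrite in_itv/= => /andP[sy yx].
  by apply: dG; rewrite sy (lt_le_trans yx).
- by move=> y; rewrite in_itv/= => /andP[sy yx]; apply: gE; rewrite sy (lt_le_trans yx).
Qed.

Lemma C1_mul s t G K : C1_closed s t G -> C1_closed s t K ->
  C1_closed s t (fun x => G x * K x).
Proof.
move=> [cG [dG [g [cg gE]]]] [cK [dK [k [ck kE]]]]; split; [|split].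
- by move=> x; apply: (@continuousM _ (subspace `[s, t])); [exact: cG|exact: cK].
- by move=> x xst; apply: derivableM; [exact: dG|exact: dK].
exists (fun x => g x * K x + G x * k x); split.
  move=> x; apply: (@continuousD _ _ (subspace `[s, t]) (fun x => g x * K x)).
  - by apply: (@continuousM _ (subspace `[s, t])); [exact: cg|exact: cK].
  - by apply: (@continuousM _ (subspace `[s, t])); [exact: cG|exact: ck].
move=> x xst; rewrite derive1E deriveM; [|exact: dG|exact: dK].
by rewrite -!derive1E gE// kE// /GRing.scale/=; ring.
Qed.

Lemma C1_inv s t G : (forall x, s <= x <= t -> G x != 0) -> C1_closed s t G ->
  C1_closed s t (fun x => (G x)^-1).
Proof.
move=> G0 [cG [dG [g [cg gE]]]].
have cV : {within `[s, t], continuous (fun x => (G x)^-1)}.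
  rewrite continuous_subspace_in => x; rewrite inE/= in_itv/= => xst.
  by apply: (@continuousV _ (subspace `[s, t])); [exact: G0|exact: cG].
split => //; split.
- move=> x xst; apply: derivableV; last exact: dG.
  by apply: G0; case/andP: xst => /ltW -> /ltW.
exists (fun x => - ((G x)^-1 * (G x)^-1) * g x); split.
  move=> x; apply: (@continuousM _ (subspace `[s, t]) (fun x => - ((G x)^-1 * (G x)^-1))); last exact: cg.
  apply: (@continuousN _ _ (subspace `[s, t]) (fun x => (G x)^-1 * (G x)^-1)).
  by apply: (@continuousM _ (subspace `[s, t])); exact: cV.
move=> x xst; rewrite derive1E deriveV; [|by apply: G0; case/andP: xst => /ltW -> /ltW|exact: dG].
by rewrite -!derive1E gE// /GRing.scale/= -exprVn expr2.
Qed.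

Lemma C1_cvg_left s t G : s < t -> C1_closed s t G -> G @ t^'- --> G t.
Proof. by move=> st [/(continuous_within_itvP _ st)[]]. Qed.

Lemma C1_cvg_right s t G : s < t -> C1_closed s t G -> G @ s^'+ --> G s.
Proof. by move=> st [/(continuous_within_itvP _ st)[]]. Qed.

Lemma C1_lim_left s t G g : s < t -> C1_closed s t G ->
  (forall x, s < x < t -> g x = G x) -> lim (g @ at_left t) = G t.
Proof.
move=> st cG gG; apply: cvg_lim => //; apply: cvg_trans (C1_cvg_left st cG).
apply: near_eq_cvg; near=> x; apply/esym/gG/andP; split; near: x.
- exact: nbhs_left_gt.
- exact: nbhs_left_lt.
Unshelve. all: by end_near. Qed.

Lemma C1_lim_right s t G g : s < t -> C1_closed s t G ->
  (forall x, s < x < t -> g x = G x) -> lim (g @ at_right s) = G s.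
Proof.
move=> st cG gG; apply: cvg_lim => //; apply: cvg_trans (C1_cvg_right st cG).
apply: near_eq_cvg; near=> x; apply/esym/gG/andP; split; near: x.
- exact: nbhs_right_gt.
- exact: nbhs_right_lt.
Unshelve. all: by end_near. Qed.

Lemma C1_ge s t G (m : R) : s < t -> C1_closed s t G -> (forall x, s < x < t -> m <= G x) ->
  forall x, s <= x <= t -> m <= G x.
Proof.
move=> st cG Gm x /andP[]; rewrite le_eqVlt => /predU1P[<- _|sx].
  rewrite -(cvg_lim _ (C1_cvg_right st cG))//; apply: limr_ge.
    by apply/cvg_ex; exists (G s); exact: C1_cvg_right cG.
  near=> y; apply: Gm; apply/andP; split; near: y.
  - exact: nbhs_right_gt.
  - exact: nbhs_right_lt.
rewrite le_eqVlt => /predU1P[->|xt]; last by apply: Gm; rewrite sx.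
rewrite -(cvg_lim _ (C1_cvg_left st cG))//; apply: limr_ge.
  by apply/cvg_ex; exists (G t); exact: C1_cvg_left cG.
near=> y; apply: Gm; apply/andP; split; near: y.
- exact: nbhs_left_gt.
- exact: nbhs_left_lt.
Unshelve. all: by end_near. Qed.

Lemma derive1_eq_itv s t g G x : (forall x, s < x < t -> g x = G x) -> s < x < t ->
  derive1 g x = derive1 G x.
Proof.
move=> gG /andP[sx xt]; rewrite !derive1E; apply: near_eq_derive => //.
near=> y; apply: gG; apply/andP; split; near: y.
- exact: lt_nbhsr.
- exact: lt_nbhsl.
Unshelve. all: by end_near. Qed.

(** A violation at an interior point persists on an open interval around it by continuity, and that
    interval would be a null set of positive length. This turns the essential bound behind [Q] into
    a pointwise one. *)
Lemma ae_le_continuous s t G (Q : R) : s < t -> C1_closed s t G ->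
  {ae mu, forall x : RT, s < x < t -> `|G x| <= Q} ->
  forall x, s < x < t -> `|G x| <= Q.
Proof.
move=> st [cG _] aeG x /andP[sx xt]; rewrite leNgt; apply/negP => GQ.
have cGx : {for x, continuous G}.
  by apply: within_continuous_continuous cG _ => //; rewrite in_itv/= sx.
have GQ' : \forall y \near x, Q < `|G y|.
  exact: cvgr_gt (cvg_norm cGx) _ GQ.
have : \forall y \near x, s < y < t /\ Q < `|G y|.
  near=> y; split.
    apply/andP; split; near: y; [exact: lt_nbhsr|exact: lt_nbhsl].
  near: y; exact: GQ'.
move=> [e /= e0 He].
have neg : mu.-negligible (`]x - e, x + e[ : set RT).
  apply: negligibleS aeG => y /=; rewrite in_itv/= => /andP[y1 y2].
  have [] := He y; first by rewrite /= ltr_norml; apply/andP; split; lra.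
  by move=> yst Qy /(_ yst); rewrite leNgt Qy.
have := @measure_negligible _ RT _ _ `]x - e, x + e[ (measurable_itv _) neg.
rewrite /= [X in X = _](lebesgue_measure_itv `]x - e, x + e[) /= lte_fin.
have -> : x - e < x + e by lra.
by rewrite -EFinD => -[]; lra.
Unshelve. all: by end_near. Qed.

(** * Partitions and piecewise C^1 functions *)

Section Partition.
Variables (L : R) (N : nat) (z : nat -> R).
Hypothesis zP : is_partition L N z.

Lemma partition_le i j : (i <= j)%N -> (j <= N)%N -> z i <= z j.
Proof.
have [_ [_ [_ zlt]]] := zP.
elim: j => [|j IH]; first by rewrite leqn0 => /eqP ->.
rewrite leq_eqVlt => /predU1P[-> //|]; rewrite ltnS => ij jN.
by rewrite (le_trans (IH ij (ltnW jN)))// ltW// zlt.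
Qed.

Lemma partition_itv j : (j <= N)%N -> -L <= z j <= L.
Proof.
have [N0 [z0 [zN _]]] := zP.
by move=> jN; rewrite -z0 -zN; apply/andP; split; exact: partition_le.
Qed.

Lemma partition_lt j : (0 < j <= N)%N -> z j.-1 < z j.
Proof. by have [_ [_ [_ zlt]]] := zP; case: j => // j /= jN; exact: zlt. Qed.

Lemma pwC1_piece g : pwC1 N z g -> forall j, (0 < j <= N)%N ->
  exists2 G, C1_closed (z j.-1) (z j) G & forall x, z j.-1 < x < z j -> g x = G x.
Proof.
move=> gP j jN; have [G [cG gG]] := gP j jN; exists G => // x /andP[zx xz].
apply: gG; rewrite ?ltW// => xE; move: zx xz; rewrite xE ltxx//.
Qed.

Lemma pwC1_mul f g : pwC1 N z f -> pwC1 N z g -> pwC1 N z (fun x => f x * g x).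
Proof.
move=> fP gP j jN; have [F [cF fF]] := fP j jN; have [G [cG gG]] := gP j jN.
exists (fun x => F x * G x); split; first exact: C1_mul.
by move=> x xz x1 x2; rewrite fF// gG.
Qed.

(** At the ends of a piece the representative [G] may differ from [g], so its lower bound there is
    obtained as a limit from inside; this keeps [G] nonzero on the closed piece. *)
Lemma pwC1_inv g (m : R) : 0 < m -> (forall x, -L <= x <= L -> m <= g x) ->
  pwC1 N z g -> pwC1 N z (fun x => (g x)^-1).
Proof.
move=> m0 gm gP j jN; have [G [cG gG]] := gP j jN.
have zz := partition_lt jN.
have jN' : (j <= N)%N by case/andP: jN.
have Gm : forall x, z j.-1 <= x <= z j -> m <= G x.
  apply: (C1_ge zz cG) => x /andP[zx xz]; rewrite -gG.
  - apply: gm; have /andP[l1 _] := partition_itv (leq_trans (leq_pred j) jN').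
    have /andP[_ l2] := partition_itv jN'.
    by rewrite (le_trans l1 (ltW zx)) (le_trans (ltW xz) l2).
  - by rewrite !ltW.
  - by move=> xE; move: zx; rewrite xE ltxx.
  - by move=> xE; move: xz; rewrite xE ltxx.
exists (fun x => (G x)^-1); split.
  by apply: C1_inv => // x xz; rewrite gt_eqF// (lt_le_trans m0)// Gm.
by move=> x xz x1 x2; rewrite gG.
Qed.

(** Only interior partition points may carry a free value; at the outer end [z N = L] the function
    equals its representative, which is continuous. *)
Lemma pwC1_lim_L g : pwC1 N z g -> lim (g @ at_left L) = g L.
Proof.
have [N0 [z0 [zN _]]] := zP => gP.
have jN : (0 < N <= N)%N by rewrite N0 leqnn.
have zz := partition_lt jN.
have [G [cG gG]] := gP N jN.
rewrite -zN gG//; last 2 first.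
- by rewrite lexx ltW.
- by move=> xE; move: zz; rewrite xE ltxx.
apply: (C1_lim_left zz cG) => x /andP[zx xz].
by apply: gG; rewrite ?ltW// => xE; move: zx xz; rewrite xE ltxx.
Qed.

Lemma pwC1_lim_NL g : pwC1 N z g -> lim (g @ at_right (-L)) = g (-L).
Proof.
have [N0 [z0 [zN _]]] := zP => gP.
have jN : (0 < 1 <= N)%N by rewrite N0.
have zz := partition_lt jN.
have [G [cG gG]] := gP 1%N jN.
rewrite -z0 gG//; last 2 first.
- by rewrite lexx ltW.
- by move=> xE; move: zz; rewrite /= xE ltxx.
apply: (C1_lim_right zz cG) => x /andP[zx xz].
by apply: gG; rewrite ?ltW// => xE; move: zx xz; rewrite xE ltxx.
Qed.

(** The step of every induction over the pieces. The case [k = 0] is set apart because [z 0 = -L] is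
    not a point of the open interval. *)
Lemma itv_oo_partition k : (k < N)%N ->
  (`]-L, z k.+1[%classic = (`]-L, z k[ `|` [set z k]) `|` `]z k, z k.+1[ :> set RT) \/
  k = 0%N.
Proof.
case: k => [|k] kN; [by right|left].
have zz : z k.+1 < z k.+2 by exact: (@partition_lt k.+2).
have Lz : -L < z k.+1.
  have [_ [z0 _]] := zP; rewrite -z0; apply: le_lt_trans (@partition_lt k.+1 _).
    by apply: partition_le => //; exact: ltnW (ltnW kN).
  by rewrite /= ltnW.
apply/seteqP; split => x /=; rewrite !in_itv/=.
  move=> /andP[x1 x2]; case: (ltgtP x (z k.+1)) => xz; rewrite ?x1 ?x2; by [left; left|right|left; right].
move=> [[/andP[-> /= xz]|->]|/andP[xz ->]].
- exact: lt_trans zz.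
- by rewrite Lz zz.
- by rewrite (lt_trans Lz xz).
Qed.

(** Pieces and separating points are glued one at a time; the value at a separating point is
    arbitrary, hence its own entry in the maximum. *)
Lemma pwC1_measurable_bounded g : pwC1 N z g -> forall k, (k <= N)%N ->
  mfun `]-L, z k[ g /\ exists M : R, forall x, -L < x < z k -> `|g x| <= M.
Proof.
move=> gP; have [N0 [z0 [zN _]]] := zP.
have piece k : (k < N)%N -> mfun `]z k, z k.+1[ g /\
    exists M : R, forall x, z k < x < z k.+1 -> `|g x| <= M.
  move=> kN; have [G cG gG] := pwC1_piece gP (j := k.+1) kN.
  have cc : {within `[z k, z k.+1], continuous G} by case: cG.
  split.
    apply: (@eq_measurable_fun _ _ RT R _ G).
      by move=> x; rewrite inE/= in_itv/= => /gG.
    apply: measurable_funS (within_continuous_measurable cc) => //.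
    exact: subset_itv_oo_cc.
  have [M GM] := within_continuous_bounded cc; exists M => x xz.
  by rewrite gG//; apply: GM; case/andP: xz => /ltW -> /ltW.
elim=> [|k IH] kN.
  rewrite z0 set_itvE; split; first exact: measurable_fun_set0.
  by exists 0 => x /andP[x1 x2]; have := lt_trans x1 x2; rewrite ltxx.
have [mp [M1 gM1]] := piece k kN.
have [E|k0] := itv_oo_partition kN; last first.
  by move: mp gM1; rewrite k0 z0 => mp gM1; split => //; exists M1.
have [mk [M2 gM2]] := IH (ltnW kN).
rewrite E; split.
  apply/measurable_funU => //; first exact: measurableU.
  by split => //; apply/measurable_funU => //; split => //; exact: measurable_fun_set1.
exists (Num.max M1 (Num.max M2 `|g (z k)|)) => x xL.
have : (`]-L, z k.+1[%classic : set RT) x by rewrite /= in_itv.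
rewrite E /= !in_itv/= !le_max => -[[/gM2 ->|->]|/gM1 ->]; by rewrite ?lexx ?orbT.
Qed.

Lemma pwC1_measurable g : pwC1 N z g -> mfun `]-L, L[ g.
Proof.
have [_ [_ [zN _]]] := zP.
by move=> /pwC1_measurable_bounded /(_ N (leqnn N)); rewrite zN => -[].
Qed.

Lemma Linf_norm_ge0 q : 0 <= Linf_norm L q.
Proof. by apply: fine_ge0; exact: Lnorm_ge0. Qed.

(** [Linf_norm] is the [fine] of an extended real, which would be 0 for an infinite essential
    supremum; boundedness of [q] excludes this. *)
Lemma pwC1_ae_Linf q : pwC1 N z q ->
  {ae mu, forall x : RT, -L < x < L -> `|q x| <= Linf_norm L q}.
Proof.
move=> qP; have [_ [_ [zN _]]] := zP.
have [_ [M qM]] := pwC1_measurable_bounded qP (leqnn N).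
(* The norm with exponent [+oo] is the essential supremum only for a measure that is not zero. *)
have muT : (0 < mu [set: RT])%E.
  by have := @lebesgue_measure_itv R `]-oo, +oo[; rewrite set_itvNyy /= => ->; rewrite ltry.
pose F := fun x : RT => (\1_(Omega L) x * q x)%:E.
have LE : Lnorm mu +oo%E F = ess_sup mu (abse \o F) by rewrite unlock /Lnorm.body/= muT.
have LM : (ess_sup mu (abse \o F) <= (Num.max M 0)%:E)%E.
  apply/ess_supP; apply: aeW => x; rewrite /F/= lee_fin indicE.
  case: (boolP (x \in _)); rewrite ?mul0r ?normr0 ?mul1r le_max ?lexx ?orbT//.
  by rewrite inE/Omega/= in_itv/= -{2}zN => /qM ->.
have L0 : (0 <= ess_sup mu (abse \o F))%E by rewrite -LE Lnorm_ge0.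
have Lfin : ess_sup mu (abse \o F) = (Linf_norm L q)%:E.
  have -> : Linf_norm L q = fine (Lnorm mu +oo%E F) by [].
  rewrite LE fineK//.
  by rewrite ge0_fin_numE// (le_lt_trans LM)// ltry.
apply: lebesgue_aeS (ess_sup_ge mu (abse \o F)) => x; rewrite Lfin /F/= lee_fin.
move=> qx xL; move: qx; rewrite indicE mem_set ?mul1r//.
Qed.

(** Interior partition points are left out, since an essential bound says nothing about a free value
    at a single point; at [L] and [-L] the value is a one-sided limit and inherits the bound. *)
Lemma pwC1_le_Linf q : pwC1 N z q ->
  (forall j, (0 < j <= N)%N -> forall x, z j.-1 < x < z j -> `|q x| <= Linf_norm L q) /\
  (`|q L| <= Linf_norm L q /\ `|q (-L)| <= Linf_norm L q).
Proof.
move=> qP; have aeq := pwC1_ae_Linf qP.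
have [N0 [z0 [zN _]]] := zP.
have key j G : (0 < j <= N)%N -> C1_closed (z j.-1) (z j) G ->
    (forall x, z j.-1 < x < z j -> q x = G x) ->
    forall x, z j.-1 < x < z j -> `|G x| <= Linf_norm L q.
  move=> jN cG qG; apply: ae_le_continuous => //; first exact: partition_lt.
  apply: lebesgue_aeS aeq => x qx xz; rewrite -qG//; apply: qx.
  have jN' : (j <= N)%N by case/andP: jN.
  have /andP[l1 _] := partition_itv (leq_trans (leq_pred j) jN').
  have /andP[_ l2] := partition_itv jN'.
  by case/andP: xz => zx xz; rewrite (le_lt_trans l1 zx) (lt_le_trans xz l2).
have key2 j G : (0 < j <= N)%N -> C1_closed (z j.-1) (z j) G ->
    (forall x, z j.-1 < x < z j -> q x = G x) ->
    forall x, z j.-1 <= x <= z j -> `|G x| <= Linf_norm L q.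
  move=> jN cG qG x xz; have H := key j G jN cG qG; rewrite ler_norml; apply/andP; split.
    apply: (C1_ge (partition_lt jN) cG) xz => y /H.
    by rewrite ler_norml => /andP[].
  (* The upper bound at the ends is the lower bound [C1_ge] for [- G]. *)
  have cN : C1_closed (z j.-1) (z j) (fun x => -1 * G x).
    apply: C1_mul cG; split; first by move=> ?; exact: cst_continuous.
    split; first by move=> *; exact: derivable_cst.
    by exists (cst 0); split => [?|y _]; [exact: cst_continuous|rewrite derive1E derive_cst].
  have := C1_ge (partition_lt jN) cN (m := - Linf_norm L q).
  rewrite -lerN2 => /(_ _ x xz); rewrite mulN1r; apply => y /H.
  by rewrite mulN1r ler_norml lerN2 => /andP[].
split.
  by move=> j jN x xz; have [G cG qG] := pwC1_piece qP jN; rewrite qG//; exact: key xz.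
split.
  have jN : (0 < N <= N)%N by rewrite N0 leqnn.
  have [G cG qG] := pwC1_piece qP jN.
  have := key2 N G jN cG qG (z N).
  rewrite -(C1_lim_left (partition_lt jN) cG qG) zN pwC1_lim_L//; apply.
  by rewrite lexx -zN ltW// partition_lt.
have jN : (0 < 1 <= N)%N by rewrite N0.
have [G cG qG] := pwC1_piece qP jN.
have := key2 1%N G jN cG qG (z 0%N).
rewrite -(C1_lim_right (partition_lt jN) cG qG) z0 pwC1_lim_NL//; apply.
by rewrite lexx -z0 ltW// (partition_lt jN).
Qed.

End Partition.

(** * The energy inequality *)

Lemma dot2_le (x1 x2 y1 y2 : R) :
  `|x1 * y1 + x2 * y2| <= Num.sqrt (x1 ^+ 2 + x2 ^+ 2) * Num.sqrt (y1 ^+ 2 + y2 ^+ 2).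
Proof.
have x0 : 0 <= x1 ^+ 2 + x2 ^+ 2 by rewrite addr_ge0// sqr_ge0.
rewrite -sqrtrM// -sqrtr_sqr ler_wsqrtr// -subr_ge0.
(* Lagrange's identity. *)
have -> : (x1 ^+ 2 + x2 ^+ 2) * (y1 ^+ 2 + y2 ^+ 2) - (x1 * y1 + x2 * y2) ^+ 2 =
  (x1 * y2 - x2 * y1) ^+ 2 by ring.
exact: sqr_ge0.
Qed.

Section Energy.
Variables (L omega Q : R) (a c q fr fi ur ui wr wi : R -> R).
Hypotheses (a0 : forall x, -L <= x <= L -> 0 < a x).
Hypotheses (c0 : forall x, -L <= x <= L -> 0 < c x).
Let kap x := (omega / c x) ^+ 2.
Hypotheses (Aur : AC (-L) L ur (fun x => wr x / a x))
  (Aui : AC (-L) L ui (fun x => wi x / a x))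
  (Awr : AC (-L) L wr (fun x => - (fr x + kap x * ur x)))
  (Awi : AC (-L) L wi (fun x => - (fi x + kap x * ui x))).
Let U x := ur x * ur x + ui x * ui x.
Let W x := wr x * wr x + wi x * wi x.
Let e x := W x / a x + kap x * U x -
  2 * Q * (Num.sqrt (fr x ^+ 2 + fi x ^+ 2) * (Num.sqrt (wr x ^+ 2 + wi x ^+ 2) / a x)).
Hypothesis ei : intble `]-L, L[ e.

Let p1 x := q x / a x.
Let p2 x := q x / (c x) ^+ 2.

(** The right-hand side is the increment of the absolutely continuous function
    [P1 W + omega^2 P2 U], so it suffices to compare integrands in the open interval, where [P1] and
    [P2] are [q/a] and [q/c^2]. They are separate arguments because [q/a] and [q/c^2] need not equal
    their one-sided limits at [s] and [t]. *)
Lemma energy_piece s t P1 P2 : -L <= s -> s < t -> t <= L ->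
  C1_closed s t P1 -> C1_closed s t P2 ->
  (forall x, s < x < t -> p1 x = P1 x) -> (forall x, s < x < t -> p2 x = P2 x) ->
  (forall x, s < x < t -> `|q x| <= Q) ->
  (forall x, s < x < t -> 1 / a x <= derive1 p1 x /\ 1 / (c x) ^+ 2 <= derive1 p2 x) ->
  \int[mu]_(x in `]s, t[) e x <= P1 t * W t + omega ^+ 2 * (P2 t * U t) -
                                 (P1 s * W s + omega ^+ 2 * (P2 s * U s)).
Proof.
move=> Ls st tL cP1 cP2 p1E p2E qQ pd.
have [dP1 AP1 dP1E] := C1_AC st cP1; have [dP2 AP2 dP2E] := C1_AC st cP2.
have sub := AC_sub Ls (ltW st) tL.
have AW := AC_add (AC_mul (ltW st) (sub _ _ Awr) (sub _ _ Awr))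
                  (AC_mul (ltW st) (sub _ _ Awi) (sub _ _ Awi)).
have AU := AC_add (AC_mul (ltW st) (sub _ _ Aur) (sub _ _ Aur))
                  (AC_mul (ltW st) (sub _ _ Aui) (sub _ _ Aui)).
have APhi := AC_add (AC_mul (ltW st) AP1 AW)
                    (AC_scale (omega ^+ 2) (AC_mul (ltW st) AP2 AU)).
rewrite -(AC_ftc (ltW st) APhi).
have Pi : intble `]s, t[ (fun x => (dP1 x * (wr x * wr x + wi x * wi x) +
    P1 x * (- (fr x + kap x * ur x) * wr x + wr x * - (fr x + kap x * ur x) +
    (- (fi x + kap x * ui x) * wi x + wi x * - (fi x + kap x * ui x)))) +
    omega ^+ 2 * (dP2 x * (ur x * ur x + ui x * ui x) +
    P2 x * (wr x / a x * ur x + ur x * (wr x / a x) +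
    (wi x / a x * ui x + ui x * (wi x / a x))))).
  by apply: intbleS APhi.1 => //; exact: subset_itv_oo_cc.
rewrite integral_itv_oocc; last exact: intble_measurable Pi.
apply: le_Rintegral => //.
  by apply: intbleS ei => //; apply: subset_itv; rewrite bnd_simp.
move=> x; rewrite /= in_itv/= => xst.
have xL : -L <= x <= L.
  by case/andP: xst => sx xt; rewrite (le_trans Ls (ltW sx)) (le_trans (ltW xt) tL).
have [d1 d2] := pd x xst.
rewrite dP1E// dP2E// -(derive1_eq_itv p1E xst) -(derive1_eq_itv p2E xst).
rewrite -p1E// -p2E// /p1 /p2 /e.
rewrite -/(W x) -/(U x).
have W0 : 0 <= W x by rewrite addr_ge0// -expr2 sqr_ge0.
have U0 : 0 <= U x by rewrite addr_ge0// -expr2 sqr_ge0.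
have := a0 xL; have := c0 xL => cx ax.
have cx' : c x != 0 by rewrite gt_eqF.
have ax' : a x != 0 by rewrite gt_eqF.
have h1 := ler_wpM2r W0 d1.
have h2 := ler_wpM2l (sqr_ge0 omega) (ler_wpM2r U0 d2).
have h3 : q x * (fr x * wr x + fi x * wi x) <=
    Q * (Num.sqrt (fr x ^+ 2 + fi x ^+ 2) * Num.sqrt (wr x ^+ 2 + wi x ^+ 2)).
  apply: le_trans (ler_norm _) _; rewrite normrM.
  by apply: ler_pM => //; [exact: qQ|exact: dot2_le].
have h4 : 2 * (q x * (fr x * wr x + fi x * wi x)) / a x <=
    2 * (Q * (Num.sqrt (fr x ^+ 2 + fi x ^+ 2) * Num.sqrt (wr x ^+ 2 + wi x ^+ 2))) / a x.
  by rewrite ler_wpM2r ?invr_ge0 ?(ltW ax)// ler_wpM2l.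
set D1 := derive1 _ _ in h1 *; set D2 := derive1 _ _ in h2 *.
set SF := Num.sqrt _ in h4 *; set SW := Num.sqrt (wr x ^+ 2 + _) in h4 *.
(* The cross terms cancel: [(q/a) W'] contains [- 2 (q/a) (omega/c)^2 (ur wr + ui wi)] and
   [omega^2 (q/c^2) U'] is its opposite. The remaining term in [f] is bounded by [h4]. *)
have -> : (D1 * W x + q x / a x *
    (- (fr x + kap x * ur x) * wr x + wr x * - (fr x + kap x * ur x) +
    (- (fi x + kap x * ui x) * wi x + wi x * - (fi x + kap x * ui x)))) +
    omega ^+ 2 * (D2 * U x + q x / c x ^+ 2 * (wr x / a x * ur x + ur x * (wr x / a x) +
    (wi x / a x * ui x + ui x * (wi x / a x)))) =
  D1 * W x + omega ^+ 2 * (D2 * U x) - 2 * (q x * (fr x * wr x + fi x * wi x)) / a x.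
  by rewrite /kap; field; rewrite cx' ax'.
have -> : W x / a x + kap x * U x - 2 * Q * (SF * (SW / a x)) =
  1 / a x * W x + omega ^+ 2 * (1 / c x ^+ 2 * U x) - 2 * (Q * (SF * SW)) / a x.
  by rewrite /kap; field; rewrite cx' ax'.
lra.
Qed.

Variables (N : nat) (z : nat -> R) (m : R).
Hypotheses (zP : is_partition L N z) (m0 : 0 < m).
Hypotheses (am : forall x, -L <= x <= L -> m <= a x)
  (cm : forall x, -L <= x <= L -> m <= c x ^+ 2).
Hypotheses (qP : pwC1 N z q) (aP : pwC1 N z a) (cP : pwC1 N z c).
Hypothesis qQ : forall j, (0 < j <= N)%N -> forall x, z j.-1 < x < z j -> `|q x| <= Q.
Hypothesis pd : forall j, (0 < j <= N)%N -> forall x, z j.-1 < x < z j ->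
  1 / a x <= derive1 p1 x /\ 1 / (c x) ^+ 2 <= derive1 p2 x.
Hypothesis pj : forall j, (0 < j < N)%N -> jump p1 (z j) <= 0 /\ jump p2 (z j) <= 0.

Let p1P : pwC1 N z p1. Proof. by apply: pwC1_mul => //; exact: pwC1_inv m0 am aP. Qed.
Let p2P : pwC1 N z p2.
Proof.
apply: pwC1_mul => //; apply: (pwC1_inv zP m0 cm).
exact: (pwC1_mul cP cP).
Qed.

(* One-sided limits of the energy at the partition points. *)
Let El j := lim (p1 @ at_left (z j)) * W (z j) + omega ^+ 2 * (lim (p2 @ at_left (z j)) * U (z j)).
Let Er j := lim (p1 @ at_right (z j)) * W (z j) + omega ^+ 2 * (lim (p2 @ at_right (z j)) * U (z j)).

Let piece k : (k < N)%N -> \int[mu]_(x in `]z k, z k.+1[) e x <= El k.+1 - Er k.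
Proof.
move=> kN; have zz : z k < z k.+1 by exact: (partition_lt zP (j := k.+1)).
have [P1 cP1 p1E] := pwC1_piece p1P (j := k.+1) kN.
have [P2 cP2 p2E] := pwC1_piece p2P (j := k.+1) kN.
have /andP[l1 _] := partition_itv zP (ltnW kN); have /andP[_ l2] := partition_itv zP kN.
rewrite /El /Er (C1_lim_left zz cP1 p1E) (C1_lim_left zz cP2 p2E).
rewrite (C1_lim_right zz cP1 p1E) (C1_lim_right zz cP2 p2E).
apply: energy_piece => //; first exact: (qQ (j := k.+1)).
exact: (pd (j := k.+1)).
Qed.

(** [W] and [U] are continuous across the partition points, so only the weights jump. As [jump] is
    left limit minus right limit and [W], [U] are nonnegative, [El k <= Er k] at interior points,
    and the bounds [El k.+1 - Er k] of the pieces telescope. *)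
Lemma energy_ineq : \int[mu]_(x in `]-L, L[) e x <=
  p1 L * W L + omega ^+ 2 * (p2 L * U L) - (p1 (-L) * W (-L) + omega ^+ 2 * (p2 (-L) * U (-L))).
Proof.
have [N0 [z0 [zN _]]] := zP.
have main k : (k < N)%N -> \int[mu]_(x in `]-L, z k.+1[) e x <= El k.+1 - Er 0.
  elim: k => [|k IH] kN; first by rewrite -{1}z0; exact: piece.
  have [E|//] := itv_oo_partition zP kN.
  have /andP[_ l2] := partition_itv zP kN.
  have ek : intble `]-L, z k.+2[ e.
    by apply: intbleS ei => //; apply: subset_itv; rewrite bnd_simp.
  move: (ek); rewrite E => ek'.
  have ek1 : intble (`]-L, z k.+1[ `|` [set z k.+1]) e.
    refine (intbleS _ _ (@subsetUl _ _ _) ek').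
    - by apply: measurableU => //; exact: measurableU.
    - exact: measurableU.
  rewrite Rintegral_setU; [|exact: measurableU|by []|by []|]; last first.
    apply/disj_setPS => y [] /=; rewrite !in_itv/= => -[/andP[_ y1]|->] /andP[y2 _].
      by have := lt_trans y1 y2; rewrite ltxx.
      by move: y2; rewrite ltxx.
  rewrite Rintegral_setU; [|by []|by []|by []|]; last first.
    by apply/disj_setPS => y [] /=; rewrite !in_itv/= => /andP[_ y1] yE; move: y1; rewrite yE ltxx.
  rewrite Rintegral_set1 addr0.
  have h1 := IH (ltnW kN); have h2 := piece kN.
  have /pj[j1 j2] : (0 < k.+1 < N)%N by [].
  have W0 : 0 <= W (z k.+1) by rewrite addr_ge0// -expr2 sqr_ge0.
  have U0 : 0 <= U (z k.+1) by rewrite addr_ge0// -expr2 sqr_ge0.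
  have h3 := ler_wpM2r W0 j1; have h4 := ler_wpM2l (sqr_ge0 omega) (ler_wpM2r U0 j2).
  have h5 : El k.+1 <= Er k.+1.
    move: h3 h4; rewrite /El /Er /jump; lra.
  lra.
have := main N.-1; rewrite prednK// leqnn => /(_ isT).
rewrite zN /El /Er zN z0 (pwC1_lim_L zP p1P) (pwC1_lim_L zP p2P).
by rewrite (pwC1_lim_NL zP p1P) (pwC1_lim_NL zP p2P).
Qed.

End Energy.

(** * From complex-valued to real-valued functions *)

Lemma ReD (x y : R[i]) : complex.Re (x + y) = complex.Re x + complex.Re y.
Proof. by case: x; case: y. Qed.
Lemma ImD (x y : R[i]) : complex.Im (x + y) = complex.Im x + complex.Im y.
Proof. by case: x; case: y. Qed.
Lemma ReN (x : R[i]) : complex.Re (- x) = - complex.Re x.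
Proof. by case: x. Qed.
Lemma ImN (x : R[i]) : complex.Im (- x) = - complex.Im x.
Proof. by case: x. Qed.
Lemma ReM (x y : R[i]) :
  complex.Re (x * y) = complex.Re x * complex.Re y - complex.Im x * complex.Im y.
Proof. by case: x; case: y. Qed.
Lemma ImM (x y : R[i]) :
  complex.Im (x * y) = complex.Re x * complex.Im y + complex.Im x * complex.Re y.
Proof. by case: x; case: y. Qed.
Lemma Re_conjc (x : R[i]) : complex.Re (conjc x) = complex.Re x.
Proof. by case: x. Qed.
Lemma Im_conjc (x : R[i]) : complex.Im (conjc x) = - complex.Im x.
Proof. by case: x. Qed.
Lemma Re_sum (I : Type) (r : seq I) (F : I -> R[i]) :
  complex.Re (\sum_(i <- r) F i) = \sum_(i <- r) complex.Re (F i).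
Proof. by apply: (big_morph _ ReD). Qed.
Lemma Im_sum (I : Type) (r : seq I) (F : I -> R[i]) :
  complex.Im (\sum_(i <- r) F i) = \sum_(i <- r) complex.Im (F i).
Proof. by apply: (big_morph _ ImD). Qed.

Definition ReIm := (ReD, ImD, ReN, ImN, ReM, ImM, Re_conjc, Im_conjc).

Lemma L2c_cabs2 D (k : R -> R[i]) : meas D -> L2c D k -> intble D (fun x => cabs2 (k x)).
Proof.
move=> mD [mr [mi ki]]; apply/integrableP; split.
  by apply/measurable_EFinP; apply: measurable_funD; exact: measurable_funX.
move: ki; apply: le_lt_trans; rewrite le_eqVlt; apply/orP; left; apply/eqP.
apply: eq_integral => x _ /=; rewrite ger0_norm// addr_ge0// sqr_ge0//.
Qed.

Lemma L2c_Re D (k : R -> R[i]) : meas D -> L2c D k -> L2 D (fun x => complex.Re (k x)).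
Proof.
move=> mD Lk; case: (Lk) => mr [mi _]; split => //.
apply: intble_le (L2c_cabs2 mD Lk) => //; first exact: measurable_funX.
by move=> x _; rewrite ger0_norm ?sqr_ge0// lerDl sqr_ge0.
Qed.

Lemma L2c_Im D (k : R -> R[i]) : meas D -> L2c D k -> L2 D (fun x => complex.Im (k x)).
Proof.
move=> mD Lk; case: (Lk) => mr [mi _]; split => //.
apply: intble_le (L2c_cabs2 mD Lk) => //; first exact: measurable_funX.
by move=> x _; rewrite ger0_norm ?sqr_ge0// lerDr sqr_ge0.
Qed.

Lemma L2c_real D f : meas D -> L2 D f -> L2c D (fun x => (f x)%:C%C).
Proof.
move=> mD [mf fi]; split => //; split; first exact: measurable_cst.
rewrite /cabs2/=; under eq_integral do rewrite expr0n addr0.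
case/integrableP: fi => _; apply: le_lt_trans; rewrite le_eqVlt; apply/orP; left; apply/eqP.
by apply: eq_integral => x _ /=; rewrite ger0_norm ?sqr_ge0.
Qed.

Lemma H1_Re L v dv : H1 L v dv ->
  AC (-L) L (fun x => complex.Re (v x)) (fun x => complex.Re (dv x)).
Proof.
move=> [Lv [Ldv vE]]; split; first exact: L2_intble (L2c_Re (measurable_itv _) Ldv).
by move=> x xL; rewrite (vE x xL) ReD.
Qed.

Lemma H1_Im L v dv : H1 L v dv ->
  AC (-L) L (fun x => complex.Im (v x)) (fun x => complex.Im (dv x)).
Proof.
move=> [Lv [Ldv vE]]; split; first exact: L2_intble (L2c_Im (measurable_itv _) Ldv).
by move=> x xL; rewrite (vE x xL) ImD.
Qed.

Lemma real_test_inH L b v dv : real_test L b v dv ->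
  inH L b (fun x => (v x)%:C%C) (fun x => (dv x)%:C%C).
Proof.
move=> [Lv Ldv [_ vE] vD]; split; last by move=> x /vD ->.
have mO : meas `]-L, L[ by [].
split; first exact: L2c_real mO Lv; split; first exact: L2c_real mO Ldv.
move=> x xL; rewrite [in LHS](vE x xL); apply/eqP; rewrite eq_complex ReD ImD /= eqxx/=.
by rewrite Rintegral_cst//= mul0r addr0.
Qed.

Lemma lebesgue_ae_itv s t (P : R -> Prop) :
  {ae mu, forall x : RT, s < x < t -> P x} -> {ae mu, forall x : RT, s <= x <= t -> P x}.
Proof.
move=> aeP.
have ae1 (r : R) : {ae mu, forall x : RT, x <> r}.
  exists [set r]; split => //; first exact: lebesgue_measure_set1.
  by move=> x /= /contrapT.
have FF := ae_filter_ringOfSetsType mu.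
have := @filterI _ _ FF _ _ (@filterI _ _ FF _ _ (ae1 s) (ae1 t)) aeP.
apply: lebesgue_aeS => x [[/eqP xs /eqP xt] Px] /andP[sx tx]; apply: Px.
by rewrite !lt_neqAle sx tx xt eq_sym xs.
Qed.

Lemma Rintegral_ae_itv s t f g : mfun `]s, t[ f -> mfun `]s, t[ g ->
  {ae mu, forall x : RT, s < x < t -> f x = g x} ->
  \int[mu]_(x in `]s, t[) f x = \int[mu]_(x in `]s, t[) g x.
Proof.
move=> mf mg fg; congr fine; apply: ae_eq_integral => //; [exact/measurable_EFinP..|].
by apply: lebesgue_aeS fg => x fg; rewrite /= in_itv/= => /fg ->.
Qed.

Lemma L2_sqrtDsqr D f g : meas D -> L2 D f -> L2 D g ->
  L2 D (fun x => Num.sqrt (f x ^+ 2 + g x ^+ 2)).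
Proof.
move=> mD [mf fi] [mg gi]; split.
  apply: (measurableT_comp (continuous_measurable_fun (@sqrt_continuous R))).
  by apply: measurable_funD; exact: measurable_funX.
apply: intble_eq (intbleD mD fi gi) => // x _.
by rewrite sqr_sqrtr// addr_ge0// sqr_ge0.
Qed.

(** * Arithmetic of the final estimate *)

(** If [E > X + Y] then [E (E - X) > E Y >= Y^2]. *)
Lemma quadratic_bound (E X Y : R) : 0 <= E -> 0 <= X -> 0 <= Y ->
  E ^+ 2 <= X * E + Y ^+ 2 -> E <= X + Y.
Proof. by move=> E0 X0 Y0 EXY; rewrite leNgt; apply/negP => h; nra. Qed.

(** Here [E] is the norm of [u], [sa] stands for [sqrt amin] and [B] for the boundary sum of
    [omega sqrt(a)/c |u|^2]. Inserting the bound on [B], the terms in [E] add up to exactly the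
    first constant, with [3 cM/cm] from the boundary and 1 from the volume; the terms in [G] have
    coefficient [(3 cM/cm + 2) / sa^2], half of the square of the second constant. *)
Lemma stability_arith (E Q nf G B sa w cm cM : R) :
  0 <= E -> 0 <= Q -> 0 <= nf -> 0 <= G -> 0 < sa -> 0 < w -> 0 < cm -> 0 < cM ->
  E ^+ 2 <= 2 * Q * (nf * (E / sa)) + Q * (3 * (w / (cm * sa)) * B + 2 / sa ^+ 2 * G) ->
  B <= 2 * (nf * (cM / w * E)) + cM / (w * sa) * G ->
  E <= 2 / sa * (1 + 3 * (cM / cm)) * Q * nf +
       2 / sa * Num.sqrt (3 / 2 * (cM / cm) + 1) * Num.sqrt Q * Num.sqrt G.
Proof.
move=> E0 Q0 nf0 G0 sa0 w0 cm0 cM0 hE hB.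
have k0 : 0 <= cM / cm by rewrite divr_ge0 ?ltW.
have X0 : 0 <= 2 / sa * (1 + 3 * (cM / cm)) * Q * nf.
  by rewrite !mulr_ge0// ?invr_ge0 ?ltW// addr_gt0// mulr_gt0// divr_gt0.
have Y0 : 0 <= 2 / sa * Num.sqrt (3 / 2 * (cM / cm) + 1) * Num.sqrt Q * Num.sqrt G.
  by rewrite !mulr_ge0// ?invr_ge0 ?ltW.
apply: quadratic_bound => //.
have -> : (2 / sa * Num.sqrt (3 / 2 * (cM / cm) + 1) * Num.sqrt Q * Num.sqrt G) ^+ 2 =
    4 / sa ^+ 2 * (3 / 2 * (cM / cm) + 1) * Q * G.
  rewrite !exprMn !sqr_sqrtr//; last lra.
  by field; rewrite !gt_eqF.
have h1 : 3 * (w / (cm * sa)) * B <=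
    3 * (w / (cm * sa)) * (2 * (nf * (cM / w * E)) + cM / (w * sa) * G).
  by rewrite ler_wpM2l// mulr_ge0// ltW// divr_gt0// mulr_gt0.
have h2 := ler_wpM2l Q0 (lerD h1 (lexx (2 / sa ^+ 2 * G))).
apply: le_trans hE _.
apply: le_trans (lerD (lexx _) h2) _.
have -> : 2 * Q * (nf * (E / sa)) + Q * (3 * (w / (cm * sa)) *
      (2 * (nf * (cM / w * E)) + cM / (w * sa) * G) + 2 / sa ^+ 2 * G) =
   2 / sa * (1 + 3 * (cM / cm)) * Q * nf * E + (3 * (cM / cm) + 2) / sa ^+ 2 * Q * G.
  by field; rewrite !gt_eqF.
rewrite lerD2l -subr_ge0.
have -> : 4 / sa ^+ 2 * (3 / 2 * (cM / cm) + 1) * Q * G -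
    (3 * (cM / cm) + 2) / sa ^+ 2 * Q * G = (3 * (cM / cm) + 2) / sa ^+ 2 * Q * G.
  by field; rewrite !gt_eqF.
rewrite !mulr_ge0// ?invr_ge0 ?sqr_ge0//; lra.
Qed.

(** * The weak formulation: flux and boundary terms *)

Lemma mem_GammaN (L : R) b x : x \in GammaN L b -> x = -L \/ x = L.
Proof.
case: b; rewrite /= !inE; last 2 first; [by move=> /eqP; left|by move=> /eqP; right|].
by move=> /orP[] /eqP; [left|right].
Qed.

Section Helmholtz.
Variables (L omega : R) (b : bcase) (a c : R -> R) (f g u du : R -> R[i]).
Hypotheses (L0 : 0 < L) (om0 : 0 < omega).
Let ur x := complex.Re (u x).
Let ui x := complex.Im (u x).
Let fr x := complex.Re (f x).
Let fi x := complex.Im (f x).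
Let gr x := complex.Re (g x).
Let gi x := complex.Im (g x).
Let kap x := (omega / c x) ^+ 2.
Let beta x := omega * Num.sqrt (a x) / c x.
Variables (aM kM : R).
Hypotheses (am : mfun `]-L, L[ a) (km : mfun `]-L, L[ kap).
Hypotheses (abnd : forall x, -L < x < L -> `|a x| <= aM)
  (kbnd : forall x, -L < x < L -> `|kap x| <= kM).
Hypothesis Lf : L2c (Omega L) f.
Hypothesis uH : inH L b u du.
Hypothesis weak : forall v dv, inH L b v dv ->
  cint (Omega L) (fun x => (a x)%:C * du x * (dv x)^*
                           - ((omega / c x) ^+ 2)%:C * u x * (v x)^*)
  - 'i * \sum_(x <- GammaN L b) ((omega * Num.sqrt (a x) / c x)%:C * u x * (v x)^*)
  = cint (Omega L) (fun x => f x * (v x)^*) + \sum_(x <- GammaN L b) g x * (v x)^*.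

Let mO : meas `]-L, L[. Proof. by []. Qed.
Let Lu : L2c (Omega L) u. Proof. by case: uH => -[]. Qed.
Let Ldu : L2c (Omega L) du. Proof. by case: uH => -[_ []]. Qed.
Let Lur := L2c_Re mO Lu.
Let Lui := L2c_Im mO Lu.
Let Ldur := L2c_Re mO Ldu.
Let Ldui := L2c_Im mO Ldu.
Let Lfr := L2c_Re mO Lf.
Let Lfi := L2c_Im mO Lf.

Let abM h : L2 `]-L, L[ h -> L2 `]-L, L[ (fun x => a x * h x).
Proof. by apply: L2_bM => // x; rewrite /= in_itv; exact: abnd. Qed.

Let kbM h : L2 `]-L, L[ h -> L2 `]-L, L[ (fun x => kap x * h x).
Proof. by apply: L2_bM => // x; rewrite /= in_itv; exact: kbnd. Qed.

(** Du Bois-Reymond's lemma is applied to the real and the imaginary part, with [d = a u'],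
    [h = f + kap u] and [T = g + i beta u]. Multiplication by [i] crosses the parts: [ui] enters the
    real one and [ur] the imaginary one. Only [|w|^2] is recorded on the boundary, so the sign of
    the normal drops out. *)
Lemma helmholtz_flux : exists wr wi,
  [/\ AC (-L) L wr (fun x => - (fr x + kap x * ur x)),
      AC (-L) L wi (fun x => - (fi x + kap x * ui x)),
      {ae mu, forall x : RT, -L < x < L -> a x * complex.Re (du x) = wr x},
      {ae mu, forall x : RT, -L < x < L -> a x * complex.Im (du x) = wi x} &
      forall x, x \in GammaN L b -> wr x * wr x + wi x * wi x =
        (gr x - beta x * ui x) ^+ 2 + (gi x + beta x * ur x) ^+ 2].
Proof.
have reweak v dv : real_test L b v dv ->
    \int[mu]_(x in `]-L, L[) ((a x * complex.Re (du x)) * dv x - (fr x + kap x * ur x) * v x) =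
    \sum_(x <- GammaN L b) (gr x - beta x * ui x) * v x.
  move=> vt; have [Lv Ldv _ _] := vt.
  have := congr1 (@complex.Re R) (weak (real_test_inH vt)).
  rewrite !(ReD, ReN, ReM, Re_sum, Im_sum) /=.
  rewrite (_ : Rintegral _ _ _ = \int[mu]_(x in `]-L, L[)
    ((a x * complex.Re (du x)) * dv x - kap x * ur x * v x)); last first.
    by apply: eq_Rintegral => x _; rewrite !ReIm /=; rewrite /kap /ur; ring.
  rewrite [X in _ = X + _](_ : _ = \int[mu]_(x in `]-L, L[) (fr x * v x)); last first.
    by apply: eq_Rintegral => x _; rewrite !ReIm /=; rewrite /fr; ring.
  have -> : \int[mu]_(x in `]-L, L[) ((a x * complex.Re (du x)) * dv x -
      (fr x + kap x * ur x) * v x) = \int[mu]_(x in `]-L, L[) ((a x * complex.Re (du x)) * dv x -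
      kap x * ur x * v x) - \int[mu]_(x in `]-L, L[) (fr x * v x).
    rewrite -RintegralB//; last 2 first.
    - by apply: intbleB => //; apply: L2_mul => //; [exact: abM|exact: kbM].
    - exact: L2_mul.
    by apply: eq_Rintegral => x _; ring.
  have -> : \sum_(x <- GammaN L b) (gr x - beta x * ui x) * v x =
      \sum_(x <- GammaN L b) complex.Re (g x * ((v x)%:C)^*) -
      \sum_(x <- GammaN L b) complex.Im ((omega * Num.sqrt (a x) / c x)%:C * u x * ((v x)%:C)^*).
    rewrite -sumrB; apply: eq_bigr => x _; rewrite !ReIm /= /gr /beta /ui; ring.
  lra.
have imweak v dv : real_test L b v dv ->
    \int[mu]_(x in `]-L, L[) ((a x * complex.Im (du x)) * dv x - (fi x + kap x * ui x) * v x) =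
    \sum_(x <- GammaN L b) (gi x + beta x * ur x) * v x.
  move=> vt; have [Lv Ldv _ _] := vt.
  have := congr1 (@complex.Im R) (weak (real_test_inH vt)).
  rewrite !(ImD, ImN, ImM, Re_sum, Im_sum) /=.
  rewrite (_ : Rintegral _ _ _ = \int[mu]_(x in `]-L, L[)
    ((a x * complex.Im (du x)) * dv x - kap x * ui x * v x)); last first.
    by apply: eq_Rintegral => x _; rewrite !ReIm /=; rewrite /kap /ui; ring.
  rewrite [X in _ = X + _](_ : _ = \int[mu]_(x in `]-L, L[) (fi x * v x)); last first.
    by apply: eq_Rintegral => x _; rewrite !ReIm /=; rewrite /fi; ring.
  have -> : \int[mu]_(x in `]-L, L[) ((a x * complex.Im (du x)) * dv x -
      (fi x + kap x * ui x) * v x) = \int[mu]_(x in `]-L, L[) ((a x * complex.Im (du x)) * dv x -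
      kap x * ui x * v x) - \int[mu]_(x in `]-L, L[) (fi x * v x).
    rewrite -RintegralB//; last 2 first.
    - by apply: intbleB => //; apply: L2_mul => //; [exact: abM|exact: kbM].
    - exact: L2_mul.
    by apply: eq_Rintegral => x _; ring.
  have -> : \sum_(x <- GammaN L b) (gi x + beta x * ur x) * v x =
      \sum_(x <- GammaN L b) complex.Im (g x * ((v x)%:C)^*) +
      \sum_(x <- GammaN L b) complex.Re ((omega * Num.sqrt (a x) / c x)%:C * u x * ((v x)%:C)^*).
    rewrite -big_split; apply: eq_bigr => x _; rewrite !ReIm /= /gi /beta /ur; ring.
  lra.
have [wr [Awr aewr wrN wrL]] := du_bois_reymond L0 (abM Ldur) (L2_add mO Lfr (kbM Lur)) reweak.
have [wi [Awi aewi wiN wiL]] := du_bois_reymond L0 (abM Ldui) (L2_add mO Lfi (kbM Lui)) imweak.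
exists wr, wi; split => // x xN.
case: (mem_GammaN xN) => xE; rewrite xE in xN *.
- by rewrite wrN// wiN//; ring.
- by rewrite wrL// wiL//; ring.
Qed.

(** Tested with [u] itself, the volume terms [a |u'|^2] and [kap |u|^2] are real, so the imaginary
    part isolates the impedance term against source and data. *)
Lemma helmholtz_boundary :
  \sum_(x <- GammaN L b) beta x * cabs2 (u x) <=
  normL2 (Omega L) f * normL2 (Omega L) u +
  \sum_(x <- GammaN L b) Num.sqrt (cabs2 (g x)) * Num.sqrt (cabs2 (u x)).
Proof.
have := congr1 (@complex.Im R) (weak uH).
rewrite !(ImD, ImN, ImM, Re_sum, Im_sum) /=.
rewrite (_ : Rintegral _ _ _ = 0); last first.
  rewrite [RHS](_ : 0 = \int[mu]_(x in `]-L, L[) 0); last by rewrite Rintegral_cst// mul0r.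
  by apply: eq_Rintegral => x _; rewrite !ReIm /=; ring.
rewrite [X in _ = X + _](_ : _ = \int[mu]_(x in `]-L, L[) (fi x * ur x - fr x * ui x)); last first.
  by apply: eq_Rintegral => x _; rewrite !ReIm /= /fi /fr /ui /ur; ring.
rewrite (_ : \sum_(x <- _) complex.Re _ = \sum_(x <- GammaN L b) beta x * cabs2 (u x)); last first.
  by apply: eq_bigr => x _; rewrite !ReIm /= /beta /cabs2; ring.
rewrite !(mul0r, mul1r, add0r) => E.
have {E} -> : \sum_(x <- GammaN L b) beta x * cabs2 (u x) =
   \int[mu]_(x in `]-L, L[) (fr x * ui x - fi x * ur x) +
   \sum_(x <- GammaN L b) - complex.Im (g x * (u x)^*).
  have -> : \int[mu]_(x in `]-L, L[) (fr x * ui x - fi x * ur x) =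
      - \int[mu]_(x in `]-L, L[) (fi x * ur x - fr x * ui x).
    by rewrite !RintegralB ?opprB//; exact: L2_mul.
  by rewrite sumrN; lra.
apply: lerD; last first.
  apply: ler_sum => x _; apply: le_trans (ler_norm _) _.
  rewrite normrN !ReIm /= /cabs2 mulrN.
  have := dot2_le (complex.Re (g x)) (complex.Im (g x)) (- complex.Im (u x)) (complex.Re (u x)).
  by rewrite sqrrN mulrN [X in _ * Num.sqrt X]addrC.
have LF := L2_sqrtDsqr mO Lfr Lfi; have LU := L2_sqrtDsqr mO Lur Lui.
have := Rintegral_cauchy_schwarz mO LF LU.
under [X in _ <= Num.sqrt X * _ -> _]eq_Rintegral do rewrite sqr_sqrtr ?addr_ge0 ?sqr_ge0//.
under [X in _ <= _ * Num.sqrt X -> _]eq_Rintegral do rewrite sqr_sqrtr ?addr_ge0 ?sqr_ge0//.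
apply: le_trans; apply: le_Rintegral => //.
- by apply: intbleB => //; exact: L2_mul.
- exact: L2_mul.
move=> x _; apply: le_trans (ler_norm _) _.
have := dot2_le (fr x) (fi x) (ui x) (- ur x).
by rewrite sqrrN mulrN [X in _ * Num.sqrt X]addrC.
Qed.

End Helmholtz.

(** Dividing [hW] by [A] gives twice [(om/C)^2 U], and the second energy term adds one more, whence
    the 3. The identity [h4] then splits off the weight [om sqrt(A) / C] of the impedance term. *)
Lemma flux_boundary_le (om amin cmin A C U W G2 : R) :
  0 < om -> 0 < amin -> 0 < cmin -> amin <= A -> cmin <= C -> 0 <= U -> 0 <= G2 ->
  W <= 2 * (om * Num.sqrt A / C) ^+ 2 * U + 2 * G2 ->
  W / A + (om / C) ^+ 2 * U <=
  3 * (om / (cmin * Num.sqrt amin)) * (om * Num.sqrt A / C * U) + 2 / Num.sqrt amin ^+ 2 * G2.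
Proof.
move=> om0 am0 cm0 aA cC U0 G0 hW.
have A0 : 0 < A by exact: lt_le_trans aA.
have C0 : 0 < C by exact: lt_le_trans cC.
have sA0 : 0 < Num.sqrt A by rewrite sqrtr_gt0.
have sa0 : 0 < Num.sqrt amin by rewrite sqrtr_gt0.
have sAE : Num.sqrt A ^+ 2 = A by rewrite sqr_sqrtr// ltW.
have sle : Num.sqrt amin <= Num.sqrt A by rewrite ler_wsqrtr.
have h1 : W / A <= (2 * (om * Num.sqrt A / C) ^+ 2 * U + 2 * G2) / A.
  by rewrite ler_wpM2r// invr_ge0 ltW.
have h2 : (2 * (om * Num.sqrt A / C) ^+ 2 * U + 2 * G2) / A =
    2 * (om / C) ^+ 2 * U + 2 / A * G2.
  transitivity (2 * (om / C) ^+ 2 * (Num.sqrt A ^+ 2 / A) * U + 2 / A * G2).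
    by field; rewrite !gt_eqF.
  by rewrite sAE divff ?mulr1// gt_eqF.
have h3 : 2 / A * G2 <= 2 / Num.sqrt amin ^+ 2 * G2.
  rewrite ler_wpM2r// ler_wpM2l// sqr_sqrtr ?(ltW am0)//.
  by rewrite lef_pV2 ?posrE.
have h4 : (om / C) ^+ 2 * U = om / (C * Num.sqrt A) * (om * Num.sqrt A / C * U).
  by field; rewrite !gt_eqF.
have h5 : om / (C * Num.sqrt A) * (om * Num.sqrt A / C * U) <=
    om / (cmin * Num.sqrt amin) * (om * Num.sqrt A / C * U).
  apply: ler_wpM2r; first by rewrite !mulr_ge0// ?invr_ge0 ltW.
  apply: ler_wpM2l; first exact: ltW.
  rewrite lef_pV2 ?posrE ?mulr_gt0//.
  by apply: ler_pM => //; exact: ltW.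
lra.
Qed.

(** Young's inequality with the impedance coefficient as weight, so that half of the impedance term
    can later be absorbed. *)
Lemma impedance_young (om amin cmax A C sg su : R) :
  0 < om -> 0 < amin -> 0 < C -> amin <= A -> C <= cmax ->
  sg * su <= (om * Num.sqrt A / C * su ^+ 2) / 2 + cmax / (om * Num.sqrt amin) * sg ^+ 2 / 2.
Proof.
move=> om0 am0 C0 aA cC.
have A0 : 0 < A by exact: lt_le_trans aA.
have sA0 : 0 < Num.sqrt A by rewrite sqrtr_gt0.
have sa0 : 0 < Num.sqrt amin by rewrite sqrtr_gt0.
have sle : Num.sqrt amin <= Num.sqrt A by rewrite ler_wsqrtr.
pose B := om * Num.sqrt A / C; have B0 : 0 < B by rewrite !mulr_gt0// invr_gt0.
have h : B^-1 * sg ^+ 2 <= cmax / (om * Num.sqrt amin) * sg ^+ 2.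
  rewrite ler_wpM2r ?sqr_ge0// /B invfM invrK mulrC.
  apply: ler_pM => //; [exact: ltW|by rewrite invr_ge0 mulr_ge0 ?ltW|].
  by rewrite lef_pV2 ?posrE ?mulr_gt0// ler_wpM2l// ltW.
have h' : 2 * (sg * su) <= B * su ^+ 2 + B^-1 * sg ^+ 2.
  rewrite -subr_ge0.
  have -> : B * su ^+ 2 + B^-1 * sg ^+ 2 - 2 * (sg * su) = B * (su - sg / B) ^+ 2.
    by field; rewrite gt_eqF.
  by rewrite mulr_ge0 ?sqr_ge0// ltW.
rewrite -/B; lra.
Qed.

Lemma cabs2_ge0 (x : R[i]) : 0 <= cabs2 x.
Proof. by rewrite addr_ge0// sqr_ge0. Qed.

End RealAnalysis.

(** * The stability estimate *)

Local Notation mu := (@lebesgue_measure _).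
Local Notation intble D f := (mu.-integrable D (EFin \o f)).
Local Notation RT R := (measurableTypeR R).

Theorem theorem5p4 (R : realType) (L : R) (b : bcase) (omega omega0 : R)
  (a c : R -> R) (amin amax cmin cmax : R) (N : nat) (z : nat -> R)
  (f : R -> R[i]) (g : R -> R[i]) (u du : R -> R[i]) (q : R -> R) :
  0 < L ->
  0 < omega0 -> omega0 <= omega ->
  0 < amin -> 0 < cmin ->
  (forall x, -L <= x <= L -> amin <= a x <= amax) ->
  (forall x, -L <= x <= L -> cmin <= c x <= cmax) ->
  is_partition L N z ->
  pwC1 N z a -> pwC1 N z c ->
  pw_monotone N z a -> pw_monotone N z c ->
  L2c (Omega L) f ->
  inH L b u du ->
  (forall v dv, inH L b v dv ->
     cint (Omega L) (fun x => (a x)%:C * du x * (dv x)^*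
                              - ((omega / c x) ^+ 2)%:C * u x * (v x)^*)
     - 'i * \sum_(x <- GammaN L b)
               ((omega * Num.sqrt (a x) / c x)%:C * u x * (v x)^*)
     = cint (Omega L) (fun x => f x * (v x)^*)
       + \sum_(x <- GammaN L b) g x * (v x)^*) ->
  pwC1 N z q ->
  (forall x, x \in GammaD L b -> q x = 0) ->
  (forall j, (0 < j <= N)%N -> forall x, z j.-1 < x < z j ->
     derive1 (fun y => q y / a y) x >= 1 / a x /\
     derive1 (fun y => q y / (c y) ^+ 2) x >= 1 / (c x) ^+ 2) ->
  (forall j, (0 < j < N)%N ->
     jump (fun y => q y / a y) (z j) <= 0 /\
     jump (fun y => q y / (c y) ^+ 2) (z j) <= 0) ->
  let Q := Linf_norm L q in
  let CI := 2 / Num.sqrt amin * (1 + 3 * (cmax / cmin)) in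
  let CII := 2 / Num.sqrt amin * Num.sqrt (3 / 2 * (cmax / cmin) + 1) in
  Num.sqrt (Rintegral (@lebesgue_measure R) (Omega L)
              (fun x => a x * cabs2 (du x) + (omega / c x) ^+ 2 * cabs2 (u x)))
  <= CI * Q * normL2 (Omega L) f + CII * Num.sqrt Q * normGN L b g.
Proof.
move=> L0 om00 om0om am0 cm0 ab cb zP aP cP _ _ Lf uH weak qP qD pd pj; cbv zeta.
set Q := Linf_norm L q.
have om0 : 0 < omega by exact: lt_le_trans om0om.
have LL : -L <= L by rewrite ge0_cp// ltW.
have ooW x : -L < x < L -> -L <= x <= L by move=> /andP[/ltW -> /ltW ->].
have a0 x : -L <= x <= L -> 0 < a x by move=> /ab/andP[/(lt_le_trans am0)].
have c0 x : -L <= x <= L -> 0 < c x by move=> /cb/andP[/(lt_le_trans cm0)].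
have cM0 : 0 < cmax.
  have /cb/andP[h1 h2] : -L <= L <= L by rewrite LL lexx.
  by rewrite (lt_le_trans cm0)// (le_trans h1).
have sa0 : 0 < Num.sqrt amin by rewrite sqrtr_gt0.
have Q0 : 0 <= Q by exact: Linf_norm_ge0.
pose kap x := (omega / c x) ^+ 2; pose beta x := omega * Num.sqrt (a x) / c x.
have abnd x : -L < x < L -> `|a x| <= amax.
  by move=> /ooW xL; have /andP[_ h] := ab x xL; rewrite gtr0_norm// a0.
have kbnd x : -L < x < L -> `|kap x| <= (omega / cmin) ^+ 2.
  move=> /ooW xL; have /andP[h _] := cb x xL; rewrite ger0_norm ?sqr_ge0//.
  rewrite lerXn2r ?nnegrE ?divr_ge0 ?(ltW om0) ?(ltW (c0 x xL)) ?(ltW cm0)//.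
  by rewrite ler_pM2l// lef_pV2 ?posrE// c0.
have ma : @measurable_fun _ _ (RT R) R `]-L, L[ a by exact: pwC1_measurable zP _ aP.
have mk : @measurable_fun _ _ (RT R) R `]-L, L[ kap.
  apply: measurable_funX; apply: measurable_funM => //.
  apply: (pwC1_measurable zP); apply: (pwC1_inv zP cm0) => // x /cb/andP[]//.
have maV : @measurable_fun _ _ (RT R) R `]-L, L[ (fun x => (a x)^-1).
  apply: (pwC1_measurable zP); apply: (pwC1_inv zP am0) => // x /ab/andP[]//.
have aVbnd x : -L < x < L -> `|(a x)^-1| <= amin^-1.
  move=> /ooW xL; have /andP[h _] := ab x xL.
  by rewrite gtr0_norm ?invr_gt0 ?a0// lef_pV2 ?posrE ?a0.
have [wr [wi [Awr Awi aewr aewi Wb]]] := helmholtz_flux L0 ma mk abnd kbnd Lf uH weak.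
have mO : @measurable _ (RT R) `]-L, L[ by [].
have [[Lu [Ldu _]] _] := uH.
have uH1 := uH.1.
pose W x := wr x * wr x + wi x * wi x.
pose U x := complex.Re (u x) * complex.Re (u x) + complex.Im (u x) * complex.Im (u x).
have W0 x : 0 <= W x by rewrite addr_ge0// -expr2 sqr_ge0.
have U0 x : 0 <= U x by rewrite addr_ge0// -expr2 sqr_ge0.
have UE x : U x = cabs2 (u x) by rewrite /U /cabs2 !expr2.
have Lwr := AC_L2 LL Awr; have Lwi := AC_L2 LL Awi.
have aVM h : L2 `]-L, L[ h -> L2 `]-L, L[ (fun x => (a x)^-1 * h x).
  by apply: L2_bM => // x; rewrite /= in_itv; exact: aVbnd.
have Aur : AC (-L) L (fun x => complex.Re (u x)) (fun x => wr x / a x).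
  apply: (AC_ae (H1_Re uH1)).
    apply: measurable_itv_oocc.
    by apply: measurable_funM => //; case: Lwr.
  apply: lebesgue_ae_itv; apply: lebesgue_aeS aewr => x wx xL.
  by rewrite -wx// mulrAC divff ?mul1r// gt_eqF// a0// ooW.
have Aui : AC (-L) L (fun x => complex.Im (u x)) (fun x => wi x / a x).
  apply: (AC_ae (H1_Im uH1)).
    apply: measurable_itv_oocc.
    by apply: measurable_funM => //; case: Lwi.
  apply: lebesgue_ae_itv; apply: lebesgue_aeS aewi => x wx xL.
  by rewrite -wx// mulrAC divff ?mul1r// gt_eqF// a0// ooW.
have Wi : intble (`]-L, L[ : set (RT R)) W by apply: intbleD => //; exact: L2_mul.
have Wai : intble (`]-L, L[ : set (RT R)) (fun x => W x / a x).
  have := intble_bM mO maV _ Wi (M := amin^-1) => H.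
  have {}H : intble (`]-L, L[ : set (RT R)) (fun x => (a x)^-1 * W x).
    by apply: H => x; rewrite /= in_itv; exact: aVbnd.
  by apply: intble_eq H => // x _; rewrite mulrC.
have Lur := L2c_Re mO Lu; have Lui := L2c_Im mO Lu.
have Ui : intble (`]-L, L[ : set (RT R)) U by apply: intbleD => //; exact: L2_mul.
have kUi : intble (`]-L, L[ : set (RT R)) (fun x => kap x * U x).
  by apply: (intble_bM mO mk _ Ui (M := (omega / cmin) ^+ 2)) => x; rewrite /= in_itv; exact: kbnd.
pose B x := W x / a x + kap x * U x.
have B0 x : -L <= x <= L -> 0 <= B x.
  move=> xL; apply: addr_ge0; first by apply: divr_ge0 => //; exact: ltW (a0 _ xL).
  by apply: mulr_ge0 => //; exact: sqr_ge0.
pose E2 := \int[mu]_(x in `]-L, L[) (W x / a x + kap x * U x).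
have E2i : intble (`]-L, L[ : set (RT R)) (fun x => W x / a x + kap x * U x).
  exact: intbleD.
have E20 : 0 <= E2.
  apply: Rintegral_ge0 => x; rewrite /= in_itv => /ooW xL.
  exact: B0.
(* Almost everywhere [w = a u'], so [a |u'|^2 = |w|^2 / a]. *)
have -> : Rintegral mu (Omega L) (fun x => a x * cabs2 (du x) + (omega / c x) ^+ 2 * cabs2 (u x)) = E2.
  apply: Rintegral_ae_itv; last 2 first.
  - exact: intble_measurable E2i.
  - have FF := ae_filter_ringOfSetsType (@lebesgue_measure R).
    apply: lebesgue_aeS (@filterI _ _ FF _ _ aewr aewi) => x [hr hi] xL.
    have ax : a x != 0 by rewrite gt_eqF// a0// ooW.
    by rewrite /W -hr// -hi// -UE -/(kap x) /cabs2; field.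
  apply: measurable_funD; last first.
    apply: measurable_funM; first exact: mk.
    exact: intble_measurable (L2c_cabs2 mO Lu).
  apply: measurable_funM; first exact: ma.
  exact: intble_measurable (L2c_cabs2 mO Ldu).
pose F x := Num.sqrt (complex.Re (f x) ^+ 2 + complex.Im (f x) ^+ 2).
pose S x := Num.sqrt (wr x ^+ 2 + wi x ^+ 2) / a x.
have LF : L2 `]-L, L[ F by apply: L2_sqrtDsqr => //; [exact: L2c_Re Lf|exact: L2c_Im Lf].
have LS : L2 `]-L, L[ S.
  have := aVM _ (L2_sqrtDsqr mO Lwr Lwi).
  by congr L2; apply/funext => x; rewrite mulrC.
have FSi := L2_mul mO LF LS.
have ei : intble (`]-L, L[ : set (RT R)) (fun x => W x / a x + kap x * U x - 2 * Q * (F x * S x)).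
  by apply: intbleB => //; exact: intbleZ.
(* One positive lower bound serving both denominators [a] and [c^2]. *)
have m0 : 0 < Num.min amin (cmin ^+ 2) by rewrite lt_min am0 exprn_gt0.
have am x : -L <= x <= L -> Num.min amin (cmin ^+ 2) <= a x.
  by move=> /ab/andP[h _]; rewrite ge_min h.
have cm x : -L <= x <= L -> Num.min amin (cmin ^+ 2) <= c x ^+ 2.
  move=> /cb/andP[h _]; rewrite ge_min lerXn2r ?orbT// nnegrE ltW//.
  exact: lt_le_trans h.
have [qQ [qL qNL]] := pwC1_le_Linf zP qP.
have := energy_ineq a0 c0 Aur Aui Awr Awi ei zP m0 am cm qP aP cP qQ pd pj.
rewrite RintegralB//; last exact: intbleZ.
rewrite RintegralZl// -/E2.
rewrite -!/(W _) -!/(U _).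
have NL1 : -L <= -L <= L by rewrite lexx.
have NL2 : -L <= L <= L by rewrite lexx LL.
(* Each end contributes [q B] up to sign, which [|q| <= Q] bounds at a Neumann end and which
   vanishes at a Dirichlet end. *)
have bdry : q L / a L * W L + omega ^+ 2 * (q L / c L ^+ 2 * U L) -
    (q (-L) / a (-L) * W (-L) + omega ^+ 2 * (q (-L) / c (-L) ^+ 2 * U (-L))) <=
    Q * \sum_(x <- GammaN L b) B x.
  have -> : q L / a L * W L + omega ^+ 2 * (q L / c L ^+ 2 * U L) -
    (q (-L) / a (-L) * W (-L) + omega ^+ 2 * (q (-L) / c (-L) ^+ 2 * U (-L))) =
    q L * B L - q (-L) * B (-L).
    by rewrite /B /kap; field; rewrite !gt_eqF ?a0 ?c0.
  have h1 : q L * B L <= Q * B L.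
    by rewrite ler_wpM2r ?B0// (le_trans (ler_norm _)).
  have h2 : - q (-L) * B (-L) <= Q * B (-L).
    by rewrite ler_wpM2r ?B0// (le_trans (ler_norm _))// normrN.
  move: qD; case: (b) => qD; rewrite /GammaN !(big_cons, big_nil).
  - lra.
  - by rewrite (qD L) ?inE//; lra.
  - by rewrite (qD (-L)) ?inE//; lra.
pose X := \sum_(x <- GammaN L b) beta x * cabs2 (u x).
pose G := \sum_(x <- GammaN L b) cabs2 (g x).
have GLL x : x \in GammaN L b -> -L <= x <= L.
  by case/mem_GammaN => ->.
have hS : \sum_(x <- GammaN L b) B x <=
    3 * (omega / (cmin * Num.sqrt amin)) * X + 2 / Num.sqrt amin ^+ 2 * G.
  rewrite !mulr_sumr -big_split/= big_seq [leRHS]big_seq; apply: ler_sum => x xN.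
  have xL := GLL x xN; have /andP[xa _] := ab x xL; have /andP[xc _] := cb x xL.
  rewrite -UE; apply: flux_boundary_le => //; first exact: cabs2_ge0.
  rewrite /W Wb// /U /cabs2 -/(beta x).
  set p1 := complex.Re (g x); set p2 := complex.Im (g x).
  set v1 := complex.Re (u x); set v2 := complex.Im (u x).
  (* These squares are the slack in [|g + i beta u|^2 <= 2 |g|^2 + 2 beta^2 |u|^2]. *)
  have := sqr_ge0 (p1 + beta x * v2); have := sqr_ge0 (p2 - beta x * v1); lra.
have hX : X <= normL2 (Omega L) f * normL2 (Omega L) u +
    (X / 2 + cmax / (omega * Num.sqrt amin) * G / 2).
  apply: le_trans (helmholtz_boundary Lf uH weak) _; rewrite lerD2l.
  rewrite /X /G mulr_sumr !mulr_suml -big_split/= big_seq [leRHS]big_seq.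
  apply: ler_sum => x xN; have xL := GLL x xN.
  have /andP[xa _] := ab x xL; have /andP[_ xc] := cb x xL.
  have := impedance_young (Num.sqrt (cabs2 (g x))) (Num.sqrt (cabs2 (u x))) om0 am0 (c0 x xL) xa xc.
  by rewrite !sqr_sqrtr ?cabs2_ge0.
(* From [c <= cmax]: [omega / c] is at least [omega / cmax]. *)
have hnu : normL2 (Omega L) u <= cmax / omega * Num.sqrt E2.
  have co0 : 0 <= cmax / omega by rewrite divr_ge0// ltW.
  rewrite -{1}[cmax / omega]ger0_norm// -sqrtr_sqr -sqrtrM ?sqr_ge0// ler_wsqrtr//.
  rewrite -RintegralZl//; apply: le_Rintegral => //.
    exact: (intbleZ _ mO E2i).
  move=> x; rewrite /Omega /= in_itv => /ooW xL; rewrite -UE.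
  have /andP[_ xc] := cb x xL.
  have h : U x <= (cmax / omega) ^+ 2 * (kap x * U x).
    rewrite mulrA -[leLHS]mul1r ler_wpM2r// /kap -exprMn -[leLHS](expr1n _ 2) lerXn2r ?nnegrE//.
      by rewrite mulr_ge0// divr_ge0// ltW// c0.
    have -> : cmax / omega * (omega / c x) = cmax / c x by field; rewrite !gt_eqF// c0.
    by rewrite ler_pdivlMr ?c0// mul1r.
  apply: le_trans h _; rewrite ler_wpM2l ?sqr_ge0// lerDr divr_ge0// ltW// a0//.
move=> en.
(* Cauchy-Schwarz, then [|w|^2 / a^2 <= (|w|^2 / a) / amin]. *)
have hFS : \int[mu]_(x in `]-L, L[) (F x * S x) <=
    normL2 (Omega L) f * (Num.sqrt E2 / Num.sqrt amin).
  apply: le_trans (Rintegral_cauchy_schwarz mO LF LS) _.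
  have -> : \int[mu]_(x in `]-L, L[) (F x ^+ 2) = Rintegral mu (Omega L) (fun x => cabs2 (f x)).
    by apply: eq_Rintegral => x _; rewrite sqr_sqrtr// cabs2_ge0.
  apply: ler_pM => //; rewrite ?sqrtr_ge0//.
  rewrite -sqrtrV ?(ltW am0)// -sqrtrM// ler_wsqrtr// -RintegralZr//.
  apply: le_Rintegral => //; first by case: LS.
    by apply: intble_eq (intbleZ amin^-1 mO E2i) => // x _; rewrite mulrC.
  move=> x; rewrite /= in_itv => /ooW xL; have /andP[xa _] := ab x xL.
  have ax := a0 x xL.
  rewrite /S exprMn sqr_sqrtr ?addr_ge0 ?sqr_ge0// expr2 mulrA.
  apply: ler_pM.
  - by rewrite divr_ge0 ?(ltW ax)// addr_ge0// sqr_ge0.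
  - by rewrite invr_ge0 ltW.
  - by rewrite /W !expr2 lerDl mulr_ge0// sqr_ge0.
  - by rewrite lef_pV2 ?posrE.
have nf0 : 0 <= normL2 (Omega L) f by exact: sqrtr_ge0.
apply: (@stability_arith R (Num.sqrt E2) Q (normL2 (Omega L) f) G X (Num.sqrt amin) omega cmin cmax);
  rewrite ?sqrtr_ge0//.
- by apply: sumr_ge0 => x _; exact: cabs2_ge0.
- rewrite sqr_sqrtr//.
  have h1 := ler_wpM2l (mulr_ge0 (ler0n R 2) Q0) hFS.
  have h2 := ler_wpM2l Q0 hS.
  lra.
(* Moving [X / 2] in [hX] to the left doubles the other terms. *)
- have h1 := ler_wpM2l nf0 hnu.
  lra.
Qed.
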